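(* There exists a constant $\epsilon_0'>0$ such that for every $k\in\mathbb{N}$ there exist constants $A_0>0$ and $C_0>0$, depending only on $\epsilon_0'$ and $k$, with the following property: for every $\epsilon\in(0,\epsilon_0')$ and every positive smooth solution $u_\epsilon$ of $P_{S^3}u_\epsilon+\epsilon u_\epsilon=-u_\epsilon^{-7}$ on $S^3$, one has $$\frac{1}{A_0}\le u_\epsilon\le A_0\quad\text{on }S^3,\qquad \|u_\epsilon\|_{C^k(S^3,g_{S^3})}\le C_0 .$$
   Context: $S^3\subset\mathbb{R}^4$ is the unit sphere with its round metric $g_{S^3}$, $\Delta_{g_{S^3}}$ is the Laplace–Beltrami operator (nonpositive spectrum), and the Paneitz operator is $P_{S^3}u=\Delta_{g_{S^3}}^2u+\frac12\Delta_{g_{S^3}}u-\frac{15}{16}u$. *)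

(* Defs.v *)
From HB Require Import structures.
From mathcomp Require Import all_boot all_order all_algebra.
From mathcomp Require Import all_classical all_reals all_analysis.

Set Implicit Arguments.
Unset Strict Implicit.
Unset Printing Implicit Defensive.

Import Order.TTheory GRing.Theory Num.Theory.
Import numFieldNormedType.Exports.

Local Open Scope classical_set_scope.
Local Open Scope ring_scope.

(* A function on S^3 is represented by a total function u : 'rV[R]_4 -> R of
   which only the values on S^3 matter: every notion below sees u through its
   restriction to S^3 or through its radial extension x |-> u (x / |x|). *)

Section Sphere.
Variable R : realType.
Local Notation V := 'rV[R]_4.

(* The norm `|x| of the library on V is the sup norm, hence these two. *)
Definition dot (x y : V) : R := \sum_(i < 4) x 0 i * y 0 i.
Definition enorm (x : V) : R := Num.sqrt (dot x x).

Definition S3 : set V := [set p | enorm p = 1].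

Definition radial (x : V) : V := (enorm x)^-1 *: x.

Definition std_basis (i : 'I_4) : V := delta_mx 0 i.

Definition partial (i : 'I_4) (f : V -> R) : V -> R :=
  fun x => 'D_(std_basis i) f x.

Definition iter_partial (s : seq 'I_4) (f : V -> R) : V -> R :=
  foldr partial f s.

(* As x |-> x / |x| is a smooth retraction (and submersion) of R^4 \ {0} onto
   S^3, u is C^oo on S^3 iff its radial extension is C^oo on R^4 \ {0}. *)
Definition smooth_S3 (u : V -> R) : Prop :=
  forall (s : seq 'I_4) (x : V), x != 0 ->
    differentiable (iter_partial s (u \o radial)) x.

(* Orthogonal projection onto the tangent space T_p S^3, for p in S^3. *)
Definition tproj (p v : V) : V := v - dot p v *: p.

(* A covariant k-tensor field T on S^3 is extended to all ambient vectors by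
   letting T p vs depend only on the tangential parts of vs. *)
Definition tensor (k : nat) := V -> k.-tuple V -> R.

(* Levi-Civita connection of the metric induced by R^4, i.e. the tangential
   part of the ambient derivative:
     (nabla T)(v, w_1, .., w_k) = (nabla_v T)(w_1, .., w_k).
   For w in T_p S^3 the tangent field W : q |-> tproj q w has W(p) = w and
   (nabla W)(p) = 0, because D_v W (p) = - dot v w *: p is normal.  Hence the
   terms T(.., nabla_v W_i, ..) of the Leibniz rule vanish at p, and what is left
   is the derivative of q |-> T q (W_1 q, .., W_k q); T already projects its
   arguments at q. *)
Definition nabla (k : nat) (T : tensor k) : tensor k.+1 := fun p vs =>
  'D_(tproj p (thead vs))
    (fun x : V => T (radial x) (map_tuple (tproj p) (behead_tuple vs))) p.

Fixpoint nabla_iter (k : nat) (u : V -> R) : tensor k :=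
  match k with
  | 0 => fun p _ => u p
  | j.+1 => nabla (@nabla_iter j u)
  end.
Arguments nabla_iter : clear implicits.

(* Trace of the Hessian. The ambient basis may be used in place of an
   orthonormal basis of T_p S^3, since the tensors ignore normal components; the
   same holds for tensor_norm. *)
Definition laplace_beltrami (u : V -> R) : V -> R := fun p =>
  \sum_(i < 4) nabla_iter 2 u p [tuple std_basis i; std_basis i].

Definition paneitz (u : V -> R) : V -> R := fun p =>
  laplace_beltrami (laplace_beltrami u) p
  + 1 / 2 * laplace_beltrami u p - 15 / 16 * u p.

Definition tensor_norm (k : nat) (T : tensor k) (p : V) : R :=
  Num.sqrt (\sum_(I : k.-tuple 'I_4) T p (map_tuple std_basis I) ^+ 2).

Definition Ck_norm (k : nat) (u : V -> R) : \bar R :=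
  (\sum_(j < k.+1)
     ereal_sup [set (tensor_norm (nabla_iter j u) p)%:E | p in S3])%E.

End Sphere.

Arguments nabla_iter {R} k u _ _.

(* Main.v *)
(* Let P be the Paneitz operator and y_p(x) = <x, p>.  Three facts are combined.
   (1) Kazdan-Warner: pairing the equation with (grad y_p + y_p/2) u kills, by
   conformal covariance of P, everything but eps, so that the mean of y_p u^2
   vanishes for every p.
   (2) P has Green function a multiple of -|x - p|: with F = u^-7 + eps u >= 0,
   kap u(p) is the mean of |x - p| F(x).  The triangle inequality gives
   |kap u(x) - m |x - p|| <= kap u(p), m being the mean of F.  If u(p) were much
   smaller than m, u^2 would be close to a multiple of |x - p|^2, contrary to
   (1).  Hence u >= c m everywhere, and integrating the equation bounds m.
   (3) P commutes with the left-invariant fields X_a of S^3, the group of unit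
   quaternions, and the kernel is 1-Lipschitz, so |X_a h| <= C sup |P h|; this
   gains one derivative at a time, uniformly in eps.

   The invariant mean on S^3 is an ultrafilter limit of Riemann sums in R^4; only
   its positivity and the vanishing of the mean of X_a f are ever used.  The
   Green function is reached through sqrt (|x - p|^2 + d^2), whose image under P
   is an explicit multiple of its power -7. *)

From HB Require Import structures.
Require Import Defs.
From mathcomp Require Import all_boot all_order all_algebra.
From mathcomp Require Import all_classical all_reals all_analysis.
From mathcomp Require Import ring lra zify.

Set Implicit Arguments.
Unset Strict Implicit.
Unset Printing Implicit Defensive.

Import Order.TTheory GRing.Theory Num.Theory.
Import numFieldNormedType.Exports.

Local Open Scope classical_set_scope.
Local Open Scope ring_scope.

(** * Differential calculus *)

(** No integral is ever computed. Write G = sqrt (|x - p|^2 + d^2) and P G = - (15/16) c_d G^-7.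
    Pairing with the constant 1 shows that c_d G^-7 has the same mean as G, so it is a positive
    kernel of controlled total mass that concentrates at p as d tends to 0. This replaces the delta
    function behind the Green formula. The mean kap of |x - p| enters only through 1 <= kap <= 2 and
    its independence of p, and the latter is itself deduced from the Green formula. The mean has to
    act on all bounded functions, so that linearity and positivity apply to non-smooth kernels such
    as |x - p| without any regularity hypothesis. Riemann sums need not converge at that generality;
    this is the reason for the ultrafilter. The bounds come from explicit inequalities instead of a
    compactness or blow-up argument, which makes them uniform in eps: for any two points of the
    sphere the values of u differ at most by a factor 20, and the integrated equation then fixes the
    scale. *)

Lemma near_eq_differentiable (K : numFieldType) (V W : normedModType K)
    (f g : V -> W) (x : V) :
  (\forall y \near x, f y = g y) -> differentiable f x -> differentiable g x.
Proof.
move=> fg df; have fgx : f x = g x := nbhs_singleton fg.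
have E : g \o shift x = cst (g x) + 'd f x +o_ 0 id.
  apply/eqaddoP => e e0.
  have /eqaddoP/(_ e e0) H := diff_locally df.
  have fg0 : \forall h \near (0 : V), f (h + x) = g (h + x).
    move: fg; rewrite [X in X -> _](near_shift 0 x).
    by apply: filterS => h /=; rewrite subr0.
  near=> h.
  have := near H h; move=> /(_ ltac:(by [])).
  rewrite !fctE /= fgx.
  by rewrite (near fg0 h).
have dE := diff_unique (@diff_continuous _ _ _ _ _ df) E.
apply/diff_locallyP; rewrite dE; split => //.
exact: (diff_continuous df).
Unshelve. all: by end_near. Qed.

Section Calculus.
Variable R : realType.
Local Notation V := 'rV[R]_4.
Implicit Types (f g : V -> R) (x v : V).

Lemma near_neq0 x : x != 0 -> \forall y \near x, y != 0.
Proof.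
move=> x0; have nx : 0 < `|x| by rewrite normr_gt0.
apply: filterS (nbhsx_ballx x `|x| nx) => y.
by rewrite -ball_normE /=; apply: contraTneq => ->; rewrite subr0 ltxx.
Qed.

Lemma derive_partial f x v : differentiable f x ->
  'D_v f x = \sum_(i < 4) v 0 i * partial i f x.
Proof.
move=> df; rewrite deriveE //.
rewrite [in LHS](row_sum_delta v) linear_sum /=; apply: eq_bigr => i _.
by rewrite linearZ /= /partial deriveE.
Qed.

(** All iterated partials of order at most n are Fréchet differentiable off the origin. Grading
    smoothness by the order is what allows induction: the derivative of 1 / f or of sqrt f involves
    the same function again, but at one order less. *)
Fixpoint Sn n f : Prop :=
  (forall x, x != 0 -> differentiable f x) /\
  if n is m.+1 then forall i, Sn m (partial i f) else True.

Lemma partial_ext f g i x : x != 0 -> (forall y, y != 0 -> f y = g y) ->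
  partial i f x = partial i g x.
Proof.
move=> x0 fg; apply: near_eq_derive.
by apply: filterS (near_neq0 x0).
Qed.

Lemma Sn_ext n f g : (forall x, x != 0 -> f x = g x) -> Sn n f -> Sn n g.
Proof.
elim: n f g => [|n IH] f g fg /= [df pf]; split => //; try move=> x x0.
- by apply: near_eq_differentiable (df _ x0); apply: filterS (near_neq0 x0).
- by apply: near_eq_differentiable (df _ x0); apply: filterS (near_neq0 x0).
- move=> i; apply: IH (pf i) => y y0.
  exact: partial_ext.
Qed.

Lemma Sn_diff n f : Sn n f -> forall x, x != 0 -> differentiable f x.
Proof. by case: n => [|n] []. Qed.

Lemma SnW n f : Sn n.+1 f -> Sn n f.
Proof.
elim: n f => [|n IH] f /= [df pf]; split => // i; exact: IH (pf i).
Qed.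

Lemma Sn_D n f g : Sn n f -> Sn n g -> Sn n (f + g).
Proof.
elim: n f g => [|n IH] f g /= [df pf] [dg pg]; split => //.
- by move=> x x0; apply: differentiableD; [exact: df|exact: dg].
- by move=> x x0; apply: differentiableD; [exact: df|exact: dg].
- move=> i; apply: Sn_ext (IH _ _ (pf i) (pg i)) => x x0.
  by rewrite fctE /= /partial deriveD //; apply/diff_derivable; [exact: df|exact: dg].
Qed.

Lemma partialM f g i x : differentiable f x -> differentiable g x ->
  partial i (f * g) x = f x * partial i g x + g x * partial i f x.
Proof.
by move=> df dg; rewrite /partial deriveM //; exact/diff_derivable.
Qed.

Lemma Sn_M n f g : Sn n f -> Sn n g -> Sn n (f * g).
Proof.
elim: n f g => [|n IH] f g sf sg /=; (split; first by
  move=> x x0; apply: differentiableM; [exact: (Sn_diff sf)|exact: (Sn_diff sg)]) => //.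
move=> i; apply: Sn_ext (Sn_D (IH _ _ (SnW sf) (proj2 sg i)) (IH _ _ (SnW sg) (proj2 sf i))).
by move=> x x0; rewrite partialM //; [exact: (Sn_diff sf)|exact: (Sn_diff sg)].
Qed.

Lemma Sn_cst n (c : R) : Sn n (cst c).
Proof.
elim: n c => [|n IH] c /=; (split; first by move=> x _; exact: differentiable_cst) => //.
by move=> i; apply: Sn_ext (IH 0) => x _; rewrite /partial derive_cst.
Qed.

Lemma partial_coord i j x : partial i (fun x : V => x 0 j) x = (i == j)%:R.
Proof.
rewrite /partial /derive.
rewrite [X in lim (X @ _)](_ : _ = fun h : R => h^-1 * h * (i == j)%:R); last first.
  apply/funext => h.
  rewrite /= /std_basis !mxE eqxx /= addrK eq_sym.
  by rewrite /GRing.scale /= mulrA.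
apply/cvg_lim => //.
apply: cvg_near_cst.
near=> h; rewrite mulVf ?mul1r //.
near: h; exact: nbhs_dnbhs_neq.
Unshelve. all: by end_near. Qed.

Lemma Sn_coord n i : Sn n (fun x : V => x 0 i).
Proof.
case: n => [|n] /=; (split; first by move=> x _; exact: differentiable_coord) => //.
move=> j; apply: Sn_ext (Sn_cst n (j == i)%:R) => x _.
by rewrite partial_coord.
Qed.

Lemma Sn_V n f : (forall x, x != 0 -> f x != 0) -> Sn n f -> Sn n (fun x => (f x)^-1).
Proof.
move=> f0; elim: n => [|n IH] sf /=; (split; first by
  move=> x x0; apply: differentiableV; [exact: (Sn_diff sf)|exact: f0]) => // i.
have H := IH (SnW sf).
apply: Sn_ext (Sn_M (Sn_cst n (-1)) (Sn_M (Sn_M H H) (proj2 sf i))) => x x0.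
rewrite !fctE /partial deriveV ?f0 //; last exact/diff_derivable/(Sn_diff sf).
by rewrite /GRing.scale /= mulN1r mulNr -exprVn expr2.
Qed.

Lemma derive_sqrt_comp f x v : differentiable f x -> 0 < f x ->
  'D_v (fun x => Num.sqrt (f x)) x = 'D_v f x * (2 * Num.sqrt (f x))^-1.
Proof.
move=> df fx0.
have ds : differentiable Num.sqrt (f x).
  by apply/derivable1_diffP; have [] := is_derive1_sqrt fx0.
rewrite -[fun x => _]/(Num.sqrt \o f) deriveE; last exact: differentiable_comp.
rewrite diff_comp //= [in RHS]deriveE //.
rewrite diff1E // /GRing.scale /= derive1E derive_sqrt //.
Qed.

Lemma Sn_sqrt n f : (forall x, x != 0 -> 0 < f x) -> Sn n f ->
  Sn n (fun x => Num.sqrt (f x)).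
Proof.
move=> f0; elim: n => [|n IH] sf /=; (split; first by
  move=> x x0; apply: (@differentiable_comp _ _ _ _ f Num.sqrt);
    [exact: (Sn_diff sf)| apply/derivable1_diffP; have [] := is_derive1_sqrt (f0 _ x0)]) => // i.
have H := IH (SnW sf).
have H1 : Sn n (fun x => (Num.sqrt (f x))^-1).
  by apply: Sn_V H => x x0; rewrite gt_eqF // sqrtr_gt0 f0.
apply: Sn_ext (Sn_M (Sn_cst n (2^-1)) (Sn_M H1 (proj2 sf i))) => x x0.
rewrite !fctE /partial derive_sqrt_comp ?f0 //; last exact: (Sn_diff sf).
by rewrite invfM; ring.
Qed.

End Calculus.

Lemma dist_aux (K : realFieldType) (e T a b c d A B : K) :
  `|a - b - c + d - T * A| <= e / 2 * T -> `|a - c - b + d - T * B| <= e / 2 * T ->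
  `|T * (A - B)| <= T * e.
Proof.
rewrite !ler_norml => /andP[H1 H2] /andP[H3 H4].
by apply/andP; split; lra.
Qed.

(** * Mean value theorem along lines and symmetry of second derivatives *)

Section Lines.
Variables (R : realType) (V : normedModType R).
Implicit Types (f g : V -> R) (x v w : V).

Lemma is_derive_line f a v (s : R) : differentiable f (a + s *: v) ->
  is_derive s 1 (fun t : R => f (a + t *: v)) ('D_v f (a + s *: v)).
Proof.
move=> df.
have E : (fun h : R => h^-1 *: (((fun t : R => f (a + t *: v)) \o shift s) (h *: 1)
             - f (a + s *: v))) =
    (fun h : R => h^-1 *: ((f \o shift (a + s *: v)) (h *: v) - f (a + s *: v))).
  apply/funext => h /=; congr (_ *: (f _ - _)).
  by rewrite [h *: 1]mulr1 scalerDl addrCA.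
have dv : derivable f (a + s *: v) v by exact: diff_derivable.
split; first by rewrite /derivable E.
by rewrite /derive E.
Qed.

Lemma line_MVT f a v (t : R) : 0 <= t ->
  (forall s, 0 <= s <= t -> differentiable f (a + s *: v)) ->
  exists2 s, 0 <= s <= t & f (a + t *: v) - f a = 'D_v f (a + s *: v) * t.
Proof.
move=> t0 df.
have [||s] := @MVT_segment R (fun s => f (a + s *: v))
  (fun s => 'D_v f (a + s *: v)) 0 t t0.
- move=> s; rewrite in_itv /= => /andP[s0 st]; apply: is_derive_line.
  by apply: df; rewrite !ltW.
- apply: derivable_within_continuous => s; rewrite in_itv /= => st.
  by have [] := is_derive_line (df _ st).
- by rewrite in_itv /= => st; rewrite scale0r addr0 subr0; exists s.
Qed.

(** Two applications of the mean value theorem, first along v to the increment [g] in direction w,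
    then along w to the derivative in direction v, turn the second difference into t^2 times a mixed
    derivative at a nearby point. *)
Lemma second_difference f x v w :
  (\forall y \near x, differentiable f y) ->
  (\forall y \near x, differentiable (fun z => 'D_v f z) y) ->
  {for x, continuous (fun y => 'D_w (fun z => 'D_v f z) y)} ->
  forall e : R, 0 < e -> \forall t \near (0 : R), 0 < t ->
    `|f (x + t *: v + t *: w) - f (x + t *: v) - f (x + t *: w) + f x
      - t ^+ 2 * 'D_w (fun z => 'D_v f z) x| <= e * t ^+ 2.
Proof.
move=> df ddf cd e e0.
have cde : \forall y \near x,
    `|'D_w (fun z => 'D_v f z) x - 'D_w (fun z => 'D_v f z) y| < e.
  by move/cvgrPdist_lt : cd; exact.
have /nbhs_normP [r /= r0 P] : \forall y \near x,
   [/\ differentiable f y, differentiable (fun z => 'D_v f z) y &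
   `|'D_w (fun z => 'D_v f z) x - 'D_w (fun z => 'D_v f z) y| < e].
  by near=> y; split; near: y.
have N0 : 0 < `|v| + `|w| + 1 by rewrite ltr_wpDl // addr_ge0.
have inball t s s' : 0 < t -> t * (`|v| + `|w| + 1) < r -> 0 <= s <= t -> 0 <= s' <= t ->
    ball_ (fun z : V => `|z|) x r (x + s *: v + s' *: w).
  move=> t0 tr /andP[s0 st] /andP[s0' st'] /=.
  rewrite -addrA opprD addNKr normrN; apply: le_lt_trans tr.
  apply: le_trans (ler_normD _ _) _; rewrite !normrZ !ger0_norm // -addrA mulrDr mulrDr.
  rewrite mulr1 addrA ler_wpDr ?(ltW t0) //.
  by apply: lerD; apply: ler_wpM2r.
have : \forall t \near (0 : R), `|t| < r / (`|v| + `|w| + 1).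
  by apply: nbhs0_lt; rewrite divr_gt0.
apply: filterS => t tr t0; move: tr; rewrite gtr0_norm // ltr_pdivlMr // => tr.
have t01 : 0 <= t <= t by rewrite ltW //=.
have t00 : 0 <= (0 : R) <= t by rewrite lexx ltW //=.
pose g y := f (y + t *: w) - f y.
have dg s : 0 <= s <= t -> differentiable f (x + s *: v + t *: w) /\ differentiable f (x + s *: v).
  move=> st; have [? _ _] := P _ (inball _ _ _ t0 tr st t01).
  by have := P _ (inball _ _ _ t0 tr st t00); rewrite scale0r addr0 => -[? _ _].
have dsh y : differentiable f (y + t *: w) ->
    is_diff y (fun z => f (z + t *: w)) ('d f (y + t *: w)).
  move=> dfy; have dy : is_diff y (fun z : V => z + t *: w) id.
    have -> : (id : V -> V) = id + 0 by rewrite addr0.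
    exact: is_diffD.
  have dy1 : differentiable (fun z : V => z + t *: w) y by have [] := dy.
  apply: DiffDef; first by apply: (@differentiable_comp _ _ _ _ (fun z : V => z + t *: w) f).
  by rewrite (@diff_comp _ _ _ _ (fun z : V => z + t *: w) f) // diff_val.
have [s st Es] : exists2 s, 0 <= s <= t & g (x + t *: v) - g x = 'D_v g (x + s *: v) * t.
  apply: line_MVT; rewrite ?ltW // => s st.
  have [d1 d2] := dg _ st; apply: differentiableB => //.
  by have [] := dsh _ d1.
have Eg : 'D_v g (x + s *: v) = 'D_v f (x + s *: v + t *: w) - 'D_v f (x + s *: v).
  have [d1 d2] := dg _ st; have [d3 d4] := dsh _ d1.
  rewrite deriveB; [|exact: diff_derivable|exact: diff_derivable].
  by congr (_ - _); rewrite !deriveE // d4.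
have [s' st' Es'] : exists2 s', 0 <= s' <= t &
    'D_v f (x + s *: v + t *: w) - 'D_v f (x + s *: v) =
    'D_w (fun z => 'D_v f z) (x + s *: v + s' *: w) * t.
  apply: (@line_MVT (fun z => 'D_v f z)); rewrite ?ltW // => s' st'.
  by have [] := P _ (inball _ _ _ t0 tr st st').
have [_ _ He] := P _ (inball _ _ _ t0 tr st st').
have -> : f (x + t *: v + t *: w) - f (x + t *: v) - f (x + t *: w) + f x =
   g (x + t *: v) - g x by rewrite /g; ring.
rewrite Es Eg Es'.
rewrite -mulrA -expr2 [_ * t ^+ 2]mulrC -mulrBr normrM distrC mulrC ger0_norm ?sqr_ge0 //.
by rewrite ler_wpM2r ?sqr_ge0 // ltW.
Unshelve. all: by end_near. Qed.

(** The second difference is symmetric in v and w, so both mixed derivatives are its limit after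
    division by t^2. *)
Lemma derive_swap f x v w :
  (\forall y \near x, differentiable f y) ->
  (\forall y \near x, differentiable (fun z => 'D_v f z) y) ->
  (\forall y \near x, differentiable (fun z => 'D_w f z) y) ->
  {for x, continuous (fun y => 'D_w (fun z => 'D_v f z) y)} ->
  {for x, continuous (fun y => 'D_v (fun z => 'D_w f z) y)} ->
  'D_w (fun z => 'D_v f z) x = 'D_v (fun z => 'D_w f z) x.
Proof.
move=> df dv dw cv cw; apply/eqP; rewrite -subr_eq0 -normr_eq0 eq_le normr_ge0 andbT.
apply/ler_addgt0Pl => e e0; rewrite addr0.
have e2 : 0 < e / 2 by rewrite divr_gt0.
have /nbhs_normP [r /= r0 P] : \forall t \near (0 : R), 0 < t ->
    `|f (x + t *: v + t *: w) - f (x + t *: v) - f (x + t *: w) + f x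
      - t ^+ 2 * 'D_w (fun z => 'D_v f z) x| <= e / 2 * t ^+ 2 /\
    `|f (x + t *: w + t *: v) - f (x + t *: w) - f (x + t *: v) + f x
      - t ^+ 2 * 'D_v (fun z => 'D_w f z) x| <= e / 2 * t ^+ 2.
  have K1 := second_difference df dv cv e2; have K2 := second_difference df dw cw e2.
  by apply: filterS2 K1 K2 => t H1 H2 t0; split; [exact: H1|exact: H2].
have t0 : 0 < r / 2 by rewrite divr_gt0.
have [|H1 H2] := P (r / 2) _ t0.
  by rewrite /= sub0r normrN gtr0_norm // ltr_pdivrMr // ltr_pMr // ltr1n.
set t := r / 2 in t0 H1 H2.
have t2 : 0 < t ^+ 2 by rewrite exprn_gt0.
rewrite -(ler_pM2l t2) -{1}(gtr0_norm t2) -normrM.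
move: H1 H2; rewrite [x + t *: w + _]addrAC.
exact: dist_aux.
Qed.

End Lines.

(** * The sphere and the quaternions *)

Section Geometry.
Variable R : realType.
Local Notation V := 'rV[R]_4.
Implicit Types (x y z v w : V) (c t : R).

Lemma dotC x y : dot x y = dot y x.
Proof. by apply: eq_bigr => i _; rewrite mulrC. Qed.

Lemma dotDr x y z : dot x (y + z) = dot x y + dot x z.
Proof. by rewrite -big_split; apply: eq_bigr => i _; rewrite mxE mulrDr. Qed.

Lemma dotZr c x y : dot x (c *: y) = c * dot x y.
Proof. by rewrite mulr_sumr; apply: eq_bigr => i _; rewrite mxE mulrCA. Qed.

Lemma dotDl x y z : dot (y + z) x = dot y x + dot z x.
Proof. by rewrite dotC dotDr !(dotC x). Qed.

Lemma dotZl c x y : dot (c *: y) x = c * dot y x.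
Proof. by rewrite dotC dotZr dotC. Qed.

Lemma dotNr x y : dot x (- y) = - dot x y.
Proof. by rewrite -scaleN1r dotZr mulN1r. Qed.

Lemma dotNl x y : dot (- x) y = - dot x y.
Proof. by rewrite dotC dotNr dotC. Qed.

Lemma dotBr x y z : dot x (y - z) = dot x y - dot x z.
Proof. by rewrite dotDr dotNr. Qed.

Lemma dotBl x y z : dot (y - z) x = dot y x - dot z x.
Proof. by rewrite dotDl dotNl. Qed.

Lemma dot_std_basis x i : dot x (std_basis R i) = x 0 i.
Proof.
rewrite /dot (bigD1 i) //= big1 => [|j ji]; first by rewrite !mxE !eqxx mulr1 addr0.
by rewrite !mxE (negbTE ji) andbF mulr0.
Qed.

Lemma dot_ge0 x : 0 <= dot x x.
Proof. by apply: sumr_ge0 => i _; rewrite -expr2 sqr_ge0. Qed.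

Lemma dot_eq0 x : (dot x x == 0) = (x == 0).
Proof.
apply/eqP/eqP => [|->]; last by apply: big1 => i _; rewrite !mxE mul0r.
move/eqP; rewrite psumr_eq0 => [/allP /= H|i _]; last by rewrite -expr2 sqr_ge0.
apply/rowP => i; have := H i (mem_index_enum i).
by rewrite mxE mulf_eq0 orbb => /eqP.
Qed.

Lemma dot_gt0 x : x != 0 -> 0 < dot x x.
Proof. by move=> x0; rewrite lt_neqAle dot_ge0 eq_sym dot_eq0 x0. Qed.

Lemma sqr_enorm x : enorm x ^+ 2 = dot x x.
Proof. by rewrite /enorm sqr_sqrtr // dot_ge0. Qed.

Lemma enorm_ge0 x : 0 <= enorm x.
Proof. exact: sqrtr_ge0. Qed.

Lemma enorm_gt0 x : x != 0 -> 0 < enorm x.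
Proof. by move=> x0; rewrite sqrtr_gt0 dot_gt0. Qed.

Lemma enormZ c x : enorm (c *: x) = `|c| * enorm x.
Proof. by rewrite /enorm dotZl dotZr mulrA -expr2 sqrtrM ?sqr_ge0 // sqrtr_sqr. Qed.

Lemma enormN x : enorm (- x) = enorm x.
Proof. by rewrite /enorm dotNl dotNr opprK. Qed.

Lemma enormB x y : enorm (x - y) = enorm (y - x).
Proof. by rewrite -enormN opprB. Qed.

Lemma S3_dot x : S3 x -> dot x x = 1.
Proof. by rewrite /S3 /= -sqr_enorm => ->; rewrite expr1n. Qed.

Lemma S3_neq0 x : S3 x -> x != 0.
Proof. by move=> /S3_dot; rewrite -dot_eq0 => ->; rewrite oner_eq0. Qed.

Lemma S3_radial x : x != 0 -> S3 (radial x).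
Proof.
move=> x0; rewrite /S3 /= /radial enormZ ger0_norm ?invr_ge0 ?enorm_ge0 //.
by rewrite mulVf // gt_eqF // enorm_gt0.
Qed.

Lemma radialZ t x : 0 < t -> radial (t *: x) = radial x.
Proof.
move=> t0; rewrite /radial enormZ gtr0_norm // invfM scalerA mulrAC mulVf ?mul1r //.
by rewrite gt_eqF.
Qed.

Lemma radial_id x : S3 x -> radial x = x.
Proof. by rewrite /S3 /= /radial => ->; rewrite invr1 scale1r. Qed.

Lemma dot_le x y : dot x y <= enorm x * enorm y.
Proof.
have [->|y0] := eqVneq y 0.
  by rewrite -[0](scale0r (0 : V)) dotZr enormZ normr0 !mul0r mulr0.
have ny := enorm_gt0 y0.
have := dot_ge0 (enorm y *: x - (dot x y / enorm y) *: y).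
rewrite dotBl !dotBr !dotZl !dotZr (dotC y x) -!sqr_enorm => H.
have {H} : dot x y ^+ 2 <= (enorm x * enorm y) ^+ 2.
  rewrite -subr_ge0; move: H; congr (_ <= _).
  by field; rewrite gt_eqF.
move=> H; case: (leP 0 (dot x y)) => d0; last first.
  by apply: le_trans (ltW d0) _; rewrite mulr_ge0 ?enorm_ge0.
by rewrite -(@ler_pXn2r _ 2) // nnegrE ?mulr_ge0 ?enorm_ge0.
Qed.

Lemma normr_dot_le x y : `|dot x y| <= enorm x * enorm y.
Proof. by rewrite ler_norml dot_le andbT lerNl -dotNl -(enormN x) dot_le. Qed.

Lemma enormD x y : enorm (x + y) <= enorm x + enorm y.
Proof.
rewrite -(@ler_pXn2r _ 2) ?nnegrE ?addr_ge0 ?enorm_ge0 //.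
rewrite sqr_enorm dotDl !dotDr (dotC y x) -!sqr_enorm.
have := dot_le x y; nra.
Qed.

Lemma enorm_dist x y z : `|enorm (x - z) - enorm (x - y)| <= enorm (z - y).
Proof.
have H1 : enorm (x - z) <= enorm (x - y) + enorm (z - y).
  by rewrite (enormB z y); apply: le_trans (enormD _ _); rewrite addrA subrK.
have H2 : enorm (x - y) <= enorm (x - z) + enorm (z - y).
  by apply: le_trans (enormD _ _); rewrite addrA subrK.
by rewrite ler_norml; apply/andP; split; lra.
Qed.

Lemma sqr_enormB_S3 x y : S3 x -> S3 y -> enorm (x - y) ^+ 2 = 2 - 2 * dot x y.
Proof.
move=> /S3_dot hx /S3_dot hy.
by rewrite sqr_enorm dotBl !dotBr hx hy (dotC y x); ring.
Qed.

End Geometry.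

(** * The quaternionic frame *)

Section Quaternions.
Variable R : realType.
Local Notation V := 'rV[R]_4.
Implicit Types (x y z v w : V).

(* Right multiplication by i, j, k on x = x0 + x1 i + x2 j + x3 k. *)
Definition qtable (a : nat) : seq (seq R) := nth [::]
  [:: [:: [:: 0; 1; 0; 0]; [:: -1; 0; 0; 0]; [:: 0; 0; 0; -1]; [:: 0; 0; 1; 0]];
      [:: [:: 0; 0; 1; 0]; [:: 0; 0; 0; 1]; [:: -1; 0; 0; 0]; [:: 0; -1; 0; 0]];
      [:: [:: 0; 0; 0; 1]; [:: 0; 0; -1; 0]; [:: 0; 1; 0; 0]; [:: -1; 0; 0; 0]]] a.

Definition qmx (a : 'I_3) : 'M[R]_4 := \matrix_(i, j) nth 0 (nth [::] (qtable a) i) j.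

Definition row4 (a b c d : R) : V := \row_i nth 0 [:: a; b; c; d] i.

Lemma row4E x : exists a b c d, x = row4 a b c d.
Proof.
exists (x 0 ord0), (x 0 (lift ord0 ord0)), (x 0 (lift ord0 (lift ord0 ord0))),
  (x 0 (lift ord0 (lift ord0 (lift ord0 ord0)))).
apply/rowP => -[[|[|[|[|i]]]] Hi] //; rewrite mxE /=; congr (x _ _); exact: val_inj.
Qed.

Lemma row4_qmx a b c d :
  (row4 a b c d *m qmx 0 = row4 (- b) a d (- c)) *
  (row4 a b c d *m qmx 1 = row4 (- c) (- d) a b) *
  (row4 a b c d *m qmx 2 = row4 (- d) c (- b) a).
Proof.
by do !split; apply/rowP => -[[|[|[|[|i]]]] Hi] //;
  rewrite !mxE !big_ord_recl big_ord0 !mxE /=; ring.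
Qed.

Lemma row4_dot a b c d a' b' c' d' :
  dot (row4 a b c d) (row4 a' b' c' d') = a * a' + b * b' + c * c' + d * d'.
Proof. by rewrite /dot !big_ord_recl big_ord0 !mxE /=; ring. Qed.

Lemma row4N a b c d : - row4 a b c d = row4 (- a) (- b) (- c) (- d).
Proof. by apply/rowP => -[[|[|[|[|i]]]] Hi] //; rewrite !mxE. Qed.

Lemma ord3E (P : 'I_3 -> Prop) : P 0 -> P 1 -> P 2 -> forall a, P a.
Proof.
move=> P0 P1 P2 [[|[|[|a]]] Ha] //.
- by have -> : Ordinal Ha = 0 by exact: val_inj.
- by have -> : Ordinal Ha = 1 by exact: val_inj.
- by have -> : Ordinal Ha = 2 by exact: val_inj.
Qed.

Lemma sum_ord3 (M : nmodType) (F : 'I_3 -> M) : \sum_(a < 3) F a = F 0 + F 1 + F 2.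
Proof.
rewrite !big_ord_recl big_ord0 addr0 addrA.
by congr (F _ + F _ + F _); exact: val_inj.
Qed.

Lemma dot_qmx x a : dot x (x *m qmx a) = 0.
Proof.
have [b [c [d [e ->]]]] := row4E x.
by move: a; apply: ord3E; rewrite row4_qmx row4_dot; ring.
Qed.

Lemma dot_qmx_orth x a b : dot (x *m qmx a) (x *m qmx b) = (a == b)%:R * dot x x.
Proof.
have [p [q [r [s ->]]]] := row4E x.
by move: a b; do 2!(apply: ord3E); rewrite !row4_qmx !row4_dot /=; ring.
Qed.

(** Parseval for the orthogonal vectors x, xi, xj, xk, all of length |x|. *)
Lemma dot_qmx_frame x v w :
  dot x x * dot v w = dot v x * dot w x
    + \sum_(a < 3) dot v (x *m qmx a) * dot w (x *m qmx a).
Proof.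
have [? [? [? [? ->]]]] := row4E x; have [? [? [? [? ->]]]] := row4E v.
have [? [? [? [? ->]]]] := row4E w.
by rewrite sum_ord3 !row4_qmx !row4_dot; ring.
Qed.

Lemma qmx_mul x :
  (x *m qmx 0 *m qmx 1 = x *m qmx 2) * (x *m qmx 1 *m qmx 2 = x *m qmx 0) *
  (x *m qmx 2 *m qmx 0 = x *m qmx 1) *
  (x *m qmx 1 *m qmx 0 = - (x *m qmx 2)) * (x *m qmx 2 *m qmx 1 = - (x *m qmx 0)) *
  (x *m qmx 0 *m qmx 2 = - (x *m qmx 1)).
Proof.
have [? [? [? [? ->]]]] := row4E x.
by rewrite !row4_qmx !row4N !opprK.
Qed.

Lemma qmx_sqr x a : x *m qmx a *m qmx a = - x.
Proof.
have [? [? [? [? ->]]]] := row4E x.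
by move: a; apply: ord3E; rewrite !row4_qmx row4N.
Qed.

Lemma qmx_diag a i : qmx a i i = 0.
Proof.
by move: a; apply: ord3E; case: i => -[|[|[|[|i]]]] Hi //; rewrite mxE.
Qed.

End Quaternions.

(** * Left-invariant fields and the ring of smooth functions on the sphere *)

Section Fields.
Variable R : realType.
Local Notation V := 'rV[R]_4.
Implicit Types (f g : V -> R) (x y z v w : V) (c t : R) (a b : 'I_3).

(* Unlike [radial], this retraction takes its values in S^3 even at 0. *)
Definition rho x : V := if x == 0 then std_basis R ord0 else radial x.

Lemma S3_std_basis i : S3 (std_basis R i).
Proof. by rewrite /S3 /= /enorm dot_std_basis !mxE !eqxx sqrtr1. Qed.

Lemma S3_rho x : S3 (rho x).
Proof.
by rewrite /rho; case: eqVneq => [_|/S3_radial//]; exact: S3_std_basis.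
Qed.
Hint Resolve S3_rho : core.

Lemma rho_neq0 x : x != 0 -> rho x = radial x.
Proof. by rewrite /rho => /negbTE ->. Qed.

Lemma rho_id x : S3 x -> rho x = x.
Proof. by move=> Sx; rewrite rho_neq0 ?radial_id ?S3_neq0. Qed.

Lemma rhoK x : rho (rho x) = rho x.
Proof. exact: rho_id. Qed.

Lemma rhoZ t x : 0 < t -> rho (t *: x) = rho x.
Proof.
by move=> t0; rewrite /rho scaler_eq0 (gt_eqF t0) /= radialZ.
Qed.

Definition XD a f : V -> R := fun x => 'D_(x *m qmx R a) f x.

(** The field is linear in x, hence commutes with dilations, and so preserves homogeneity of degree
    0. *)
Lemma XD_hom a f x : (forall y, f (rho y) = f y) -> x != 0 ->
  XD a f x = XD a f (rho x).
Proof.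
move=> hf x0; rewrite /XD rho_neq0 // /radial.
have t0 : 0 < (enorm x)^-1 by rewrite invr_gt0 enorm_gt0.
have fZ y : f ((enorm x)^-1 *: y) = f y by rewrite -(hf (_ *: y)) rhoZ // hf.
rewrite [LHS]/derive [RHS]/derive.
suff -> : (fun h : R => h^-1 *: ((f \o shift x) (h *: (x *m qmx R a)) - f x)) =
   (fun h : R => h^-1 *: ((f \o shift ((enorm x)^-1 *: x))
      (h *: ((enorm x)^-1 *: x *m qmx R a)) - f ((enorm x)^-1 *: x))) by [].
apply/funext => h.
by rewrite /= -scalemxAl scalerA mulrC -scalerA -scalerDr !fZ.
Qed.

Lemma Sn_lin n a j : Sn n (fun x => (x *m qmx R a) 0 j).
Proof.
have -> : (fun y : V => (y *m qmx R a) 0 j) = \sum_(k < 4) cst (qmx R a k j) * (fun y : V => y 0 k).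
  by apply/funext => y; rewrite fct_sumE mxE; apply: eq_bigr => k _; rewrite mulrC.
by elim/big_ind : _ => [|f g|k _]; [exact: Sn_cst|exact: Sn_D|
  apply: Sn_M; [exact: Sn_cst|exact: Sn_coord]].
Qed.

Lemma partial_lin a i j x : partial i (fun y : V => (y *m qmx R a) 0 j) x = qmx R a i j.
Proof.
rewrite /partial /derive.
rewrite [X in lim (X @ _)](_ : _ = fun h : R => h^-1 * h * qmx R a i j); last first.
  apply/funext => h.
  rewrite /= mulmxDl -scalemxAl /std_basis -rowE !mxE addrK.
  by rewrite /GRing.scale /= mulrA.
apply/cvg_lim => //; apply: cvg_near_cst.
near=> h; rewrite mulVf ?mul1r //.
near: h; exact: nbhs_dnbhs_neq.
Unshelve. all: by end_near. Qed.

Lemma partial_XD a f i x : x != 0 -> Sn 1 f ->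
  partial i (XD a f) x =
  \sum_(j < 4) (qmx R a i j * partial j f x + (x *m qmx R a) 0 j * partial i (partial j f) x).
Proof.
move=> x0 [df pf].
have dlin j : differentiable (fun y : V => (y *m qmx R a) 0 j) x.
  exact: (Sn_diff (Sn_lin 0 a j)).
rewrite (@partial_ext R _ (\sum_(j < 4) (fun y : V => (y *m qmx R a) 0 j) * partial j f)) //.
  rewrite {1}/partial derive_sum; last first.
    by move=> j; apply/diff_derivable/differentiableM => //; exact: (proj1 (pf j)).
  apply: eq_bigr => j _.
  rewrite -/(partial i (_ * _) x) partialM //; last exact: (proj1 (pf j)).
  by rewrite partial_lin addrC mulrC.
by move=> y y0; rewrite /XD derive_partial ?fct_sumE //; exact: df.
Qed.

Lemma Sn_XD n a f : Sn n.+1 f -> Sn n (XD a f).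
Proof.
move=> [df pf].
apply: (@Sn_ext R n (\sum_(j < 4) (fun y : V => (y *m qmx R a) 0 j) * partial j f)).
  by move=> y y0; rewrite /XD derive_partial ?fct_sumE //; exact: df.
elim/big_ind : _ => [|g h|k _]; [exact: Sn_cst|exact: Sn_D|].
by apply: Sn_M; [exact: Sn_lin|exact: pf].
Qed.

Lemma partial_swap f i j x : x != 0 -> Sn 2 f ->
  partial i (partial j f) x = partial j (partial i f) x.
Proof.
move=> x0 [df pf].
have pd k y : y != 0 -> differentiable (partial k f) y by move=> y0; exact: (proj1 (pf k)).
have ppd k l : differentiable (partial l (partial k f)) x.
  exact: (proj1 (proj2 (pf k) l)).
apply: derive_swap.
- by apply: filterS (near_neq0 x0) => y; exact: df.
- by apply: filterS (near_neq0 x0) => y; exact: pd.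
- by apply: filterS (near_neq0 x0) => y; exact: pd.
- exact/differentiable_continuous/ppd.
- exact/differentiable_continuous/ppd.
Qed.

(** In the commutator of two linear fields the second-order terms cancel by [partial_swap]; what
    remains is the derivative along the matrix commutator. *)
Lemma XD_comm a b f x : x != 0 -> Sn 2 f ->
  XD a (XD b f) x - XD b (XD a f) x =
  'D_(x *m qmx R a *m qmx R b - x *m qmx R b *m qmx R a) f x.
Proof.
move=> x0 sf.
have E (c d : 'I_3) : XD c (XD d f) x = (\sum_(j < 4) (x *m qmx R c *m qmx R d) 0 j * partial j f x)
   + \sum_(i < 4) \sum_(j < 4) (x *m qmx R c) 0 i * (x *m qmx R d) 0 j * partial i (partial j f) x.
  rewrite {1}/XD derive_partial; last exact: (Sn_diff (Sn_XD d (SnW sf))).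
  have E1 (i : 'I_4) : (x *m qmx R c) 0 i * partial i (XD d f) x =
      (\sum_(j < 4) (x *m qmx R c) 0 i * (qmx R d i j * partial j f x)) +
      \sum_(j < 4) (x *m qmx R c) 0 i * (x *m qmx R d) 0 j * partial i (partial j f) x.
    rewrite (partial_XD d i x0 (SnW sf)) mulr_sumr -big_split.
    apply: eq_bigr => j _; rewrite /= mulrDr; congr (_ + _); exact: mulrA.
  etransitivity; first by apply: eq_bigr => i _; exact: E1.
  rewrite big_split /=; congr (_ + _).
  rewrite exchange_big /=; apply: eq_bigr => j _.
  rewrite [in RHS]mxE mulr_suml; apply: eq_bigr => i _; exact: mulrA.
have S : \sum_(i < 4) \sum_(j < 4)
     (x *m qmx R b) 0 i * (x *m qmx R a) 0 j * partial i (partial j f) x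
   = \sum_(i < 4) \sum_(j < 4) (x *m qmx R a) 0 i * (x *m qmx R b) 0 j * partial i (partial j f) x.
  rewrite exchange_big /=; apply: eq_bigr => i _; apply: eq_bigr => j _.
  rewrite (partial_swap i j x0 sf).
  exact: (congr1 (fun t : R => t * _) (mulrC _ _)).
rewrite !E S opprD addrACA subrr addr0 derive_partial; last exact: (Sn_diff sf).
rewrite -sumrB; apply: eq_bigr => i _.
rewrite -mulrBl; congr (_ * _).
have sub (P Q : V) : (P - Q) 0 i = P 0 i - Q 0 i by rewrite !mxE.
by rewrite sub.
Qed.

(** A smooth function on S^3 is encoded by its extension of degree 0. These form a subring of all
    functions, so that the type [SF] is a commutative ring and identities between functions are
    within reach of [ring]. *)
Definition smf : {pred V -> R} :=
  fun f => `[< (forall n, Sn n f) /\ forall x, f (rho x) = f x >].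

Lemma smfP f : reflect ((forall n, Sn n f) /\ forall x, f (rho x) = f x) (f \in smf).
Proof. exact: asboolP. Qed.

Lemma smf_cst c : cst c \in smf.
Proof. by apply/smfP; split => // n; exact: Sn_cst. Qed.

Lemma smf_add f g : f \in smf -> g \in smf -> f + g \in smf.
Proof.
move=> /smfP[sf hf] /smfP[sg hg]; apply/smfP; split => [n|x].
  exact: Sn_D.
by rewrite !fctE hf hg.
Qed.

Lemma smf_mul f g : f \in smf -> g \in smf -> f * g \in smf.
Proof.
move=> /smfP[sf hf] /smfP[sg hg]; apply/smfP; split => [n|x].
  exact: Sn_M.
by rewrite !fctE hf hg.
Qed.

Lemma smf_subring : subring_closed smf.
Proof.
split; first exact: smf_cst.
  move=> f g sf sg; rewrite -mulN1r; apply: smf_add => //; apply: smf_mul => //.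
  exact: (smf_cst (-1)).
exact: smf_mul.
Qed.

HB.instance Definition _ := GRing.isSubringClosed.Build (V -> R) smf smf_subring.

Record SF := MkSF { sf :> V -> R; sf_smf : sf \in smf }.

HB.instance Definition _ := [isSub for sf].
HB.instance Definition _ := [Choice of SF by <:].
HB.instance Definition _ := [SubChoice_isSubComNzRing of SF by <:].

End Fields.

Section SphereFunctions.
Variable R : realType.
Local Notation V := 'rV[R]_4.
Local Notation SF := (SF R).
Local Notation M := (qmx R).
Implicit Types (f g h : SF) (x y z p v w : V) (c t : R) (a b : 'I_3).

(** Invariance under [rho] determines even the value at the origin, so equality on the sphere is
    Leibniz equality in [SF]. *)
Lemma SF_eq f g : (forall x, S3 x -> f x = g x) -> f = g.
Proof.
move=> fg; apply: val_inj; apply/funext => x /=.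
have /smfP[_ <-] := sf_smf f; have /smfP[_ <-] := sf_smf g.
exact/fg/S3_rho.
Qed.

Lemma SF_rho f x : f (rho x) = f x.
Proof. by have /smfP[_ ->] := sf_smf f. Qed.

Lemma SF_Sn n f : Sn n f.
Proof. by have /smfP[+ _] := sf_smf f; apply. Qed.

Lemma SF_diff f x : x != 0 -> differentiable f x.
Proof. exact: (Sn_diff (SF_Sn 0 f)). Qed.

Lemma sfD f g x : (f + g) x = f x + g x. Proof. by []. Qed.
Lemma sfM f g x : (f * g) x = f x * g x. Proof. by []. Qed.
Lemma sfN f x : (- f) x = - f x. Proof. by []. Qed.
Lemma sf1 x : (1 : SF) x = 1. Proof. by []. Qed.
Lemma sf0 x : (0 : SF) x = 0. Proof. by []. Qed.
Lemma sfX f n x : (f ^+ n) x = f x ^+ n.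
Proof. by elim: n => [|n IH]; rewrite ?expr0 // !exprS sfM IH. Qed.

Definition sfc c : SF := MkSF (smf_cst c).
Lemma sfcE c x : sfc c x = c. Proof. by []. Qed.

Definition sfE := (sfD, sfM, sfN, sf1, sf0, sfX, sfcE).

Lemma smf_X a f : (fun x => XD a f (rho x)) \in @smf R.
Proof.
apply/smfP; split => [n|x]; last by rewrite rhoK.
apply: Sn_ext (Sn_XD a (SF_Sn n.+1 f)) => x x0.
by apply: XD_hom => // y; rewrite SF_rho.
Qed.

Definition sX a f : SF := MkSF (smf_X a f).

Lemma sX_neq0 a f x : x != 0 -> sX a f x = 'D_(x *m M a) f x.
Proof. by move=> x0 /=; rewrite -XD_hom // => y; rewrite SF_rho. Qed.

Lemma sXE a f x : S3 x -> sX a f x = 'D_(x *m M a) f x.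
Proof. by move/S3_neq0; exact: sX_neq0. Qed.

Lemma sXD a f g : sX a (f + g) = sX a f + sX a g.
Proof.
apply: SF_eq => x Sx; rewrite sfD !sXE //.
by apply: deriveD; exact/diff_derivable/SF_diff/S3_neq0.
Qed.

Lemma sXM a f g : sX a (f * g) = sX a f * g + f * sX a g.
Proof.
apply: SF_eq => x Sx; rewrite sfD !sfM !sXE // addrC.
rewrite [LHS]deriveM; try exact/diff_derivable/SF_diff/S3_neq0.
by congr (_ + _); rewrite mulrC.
Qed.

Lemma sXc a c : sX a (sfc c) = 0.
Proof. by apply: SF_eq => x Sx; rewrite sXE //; exact: derive_cst. Qed.

Lemma sX1 a : sX a 1 = 0.
Proof. by rewrite -(sXc a 1); congr sX; exact: val_inj. Qed.

Lemma sXN a f : sX a (- f) = - sX a f.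
Proof.
have -> : - f = sfc (-1) * f by apply: SF_eq => x _; rewrite !sfE mulN1r.
by rewrite sXM sXc mul0r add0r; apply: SF_eq => x _; rewrite !sfE mulN1r.
Qed.

Lemma sXZ a c f : sX a (sfc c * f) = sfc c * sX a f.
Proof. by rewrite sXM sXc mul0r add0r. Qed.

Lemma sX_comm a b f x : S3 x -> sX a (sX b f) x - sX b (sX a f) x =
  'D_(x *m M a *m M b - x *m M b *m M a) f x.
Proof.
move=> Sx; have x0 := S3_neq0 Sx; rewrite -(XD_comm a b x0 (SF_Sn 2 f)).
have E (c d : 'I_3) : sX c (sX d f) x = XD c (XD d f) x.
  rewrite (sXE c _ Sx); apply: (@near_eq_derive R V R (sX d f) (XD d f)).
  by apply: filterS (near_neq0 x0) => y y0; rewrite (sX_neq0 d f y0).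
by rewrite !E.
Qed.

Lemma derive_scale f x v c : x != 0 -> 'D_(c *: v) f x = c * 'D_v f x.
Proof. by move=> x0; rewrite !deriveE ?linearZ //; exact: SF_diff. Qed.

(** The relations of su(2): the commutator of two frame fields is twice the third. *)
Lemma sX_comms f :
  (sX 0 (sX 1 f) = sX 1 (sX 0 f) + 2 * sX 2 f) *
  (sX 1 (sX 2 f) = sX 2 (sX 1 f) + 2 * sX 0 f) *
  (sX 2 (sX 0 f) = sX 0 (sX 2 f) + 2 * sX 1 f).
Proof.
by do !split; apply: SF_eq => x Sx;
  rewrite sfD sfM addrC; apply/eqP; rewrite -subr_eq; apply/eqP;
  rewrite sX_comm // !qmx_mul opprK -mulr2n -scaler_nat derive_scale ?S3_neq0 // sXE.
Qed.

Lemma derive_coord x v i : 'D_v (fun y : V => y 0 i) x = v 0 i.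
Proof.
rewrite derive_partial; last exact: differentiable_coord.
rewrite (bigD1 i) //= partial_coord eqxx mulr1 big1 ?addr0 // => j ji.
by rewrite partial_coord (negbTE ji) mulr0.
Qed.

Lemma dot_sumE p : dot p = \sum_(i < 4) cst (p 0 i) * (fun y : V => y 0 i).
Proof. by apply/funext => y; rewrite fct_sumE. Qed.

Lemma Sn_dot n p : Sn n (dot p).
Proof.
rewrite dot_sumE; elim/big_ind : _ => [|f g|k _]; [exact: Sn_cst|exact: Sn_D|].
by apply: Sn_M; [exact: Sn_cst|exact: Sn_coord].
Qed.

Lemma derive_dot p x v : x != 0 -> 'D_v (dot p) x = dot p v.
Proof.
move=> x0; rewrite dot_sumE derive_sum; last first.
  move=> i; apply/diff_derivable/differentiableM => //; exact: differentiable_coord.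
rewrite fct_sumE; apply: eq_bigr => i _.
rewrite deriveM //; last exact/diff_derivable/differentiable_coord.
by rewrite derive_coord derive_cst scaler0 addr0.
Qed.

Lemma sqnorm_sumE : (fun x => dot x x) = \sum_(i < 4) (fun y : V => y 0 i) * (fun y : V => y 0 i).
Proof. by apply/funext => y; rewrite fct_sumE. Qed.

Lemma Sn_sqnorm n : Sn n (fun x : V => dot x x).
Proof.
rewrite sqnorm_sumE; elim/big_ind : _ => [|f g|k _]; [exact: Sn_cst|exact: Sn_D|].
by apply: Sn_M; exact: Sn_coord.
Qed.

Lemma derive_sqnorm x v : 'D_v (fun y => dot y y) x = 2 * dot x v.
Proof.
have dc i : derivable (fun y : V => y 0 i) x v.
  exact/diff_derivable/differentiable_coord.
rewrite sqnorm_sumE derive_sum; last by move=> i; exact: derivableM.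
rewrite mulr_sumr; apply: eq_bigr => i _.
by rewrite deriveM // derive_coord /GRing.scale /=; ring.
Qed.

Lemma Sn_enorm_inv n : Sn n (fun x : V => (enorm x)^-1).
Proof.
apply: Sn_V; first by move=> x x0; rewrite gt_eqF // enorm_gt0.
by apply: Sn_sqrt (Sn_sqnorm n) => x x0; exact: dot_gt0.
Qed.

Lemma derive_enorm_inv x v : x != 0 -> dot x v = 0 -> 'D_v (fun y => (enorm y)^-1) x = 0.
Proof.
move=> x0 xv.
have de : differentiable (@enorm R) x.
  by apply: (@Sn_diff _ 0) x0; apply: Sn_sqrt (Sn_sqnorm 0) => z z0; exact: dot_gt0.
rewrite deriveV; [|by rewrite gt_eqF // enorm_gt0|exact: diff_derivable].
rewrite /enorm derive_sqrt_comp; [|exact: (Sn_diff (Sn_sqnorm 0))|exact: dot_gt0].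
by rewrite derive_sqnorm xv mulr0 mul0r scaler0.
Qed.

Lemma dot_rho p x : x != 0 -> dot p (rho x) = dot p x * (enorm x)^-1.
Proof. by move=> x0; rewrite rho_neq0 // /radial dotZr mulrC. Qed.

Lemma smf_y p : (fun x => dot p (rho x)) \in @smf R.
Proof.
apply/smfP; split => [n|x]; last by rewrite rhoK.
apply: Sn_ext (Sn_M (Sn_dot n p) (Sn_enorm_inv n)) => x x0.
by rewrite dot_rho.
Qed.

Definition sy p : SF := MkSF (smf_y p).

Lemma syE p x : S3 x -> sy p x = dot p x.
Proof. by move=> Sx /=; rewrite rho_id. Qed.

Lemma dot_mulqmx p x a : dot p (x *m M a) = - dot (p *m M a) x.
Proof.
have := dot_qmx (p + x) a; rewrite mulmxDl dotDl !dotDr !dot_qmx add0r addr0.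
by rewrite (dotC x) => /eqP; rewrite addr_eq0 => /eqP.
Qed.

(** Along a tangential field the factor 1 / |x| of the extension is stationary, and right
    multiplication by an imaginary unit is antisymmetric. *)
Lemma sX_y a p : sX a (sy p) = - sy (p *m M a).
Proof.
apply: SF_eq => x Sx; have x0 := S3_neq0 Sx; rewrite sXE // sfN syE // -dot_mulqmx.
rewrite (@near_eq_derive _ _ _ _ (dot p * (fun y => (enorm y)^-1))); last first.
  by apply: filterS (near_neq0 x0) => y y0 /=; rewrite dot_rho.
rewrite deriveM; [|exact/diff_derivable/(Sn_diff (Sn_dot 0 p))|
  exact/diff_derivable/(Sn_diff (Sn_enorm_inv 0))].
rewrite derive_enorm_inv ?dot_qmx // derive_dot // scaler0 add0r.
by move: Sx; rewrite /S3 /= => ->; rewrite invr1 scale1r.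
Qed.

Lemma ex_sinv f : (forall x, S3 x -> f x != 0) -> exists g : SF, f * g = 1.
Proof.
move=> f0.
have H : (fun x => (f x)^-1) \in @smf R.
  apply/smfP; split => [n|x]; last by rewrite SF_rho.
  by apply: Sn_V (SF_Sn n f) => x x0; rewrite -SF_rho f0 //; exact: S3_rho.
by exists (MkSF H); apply: SF_eq => x Sx; rewrite sfM /= mulfV // f0.
Qed.

Lemma ex_ssqrt f : (forall x, S3 x -> 0 < f x) ->
  exists g : SF, g * g = f /\ forall x, S3 x -> 0 < g x.
Proof.
move=> f0.
have H : (fun x => Num.sqrt (f x)) \in @smf R.
  apply/smfP; split => [n|x]; last by rewrite SF_rho.
  by apply: Sn_sqrt (SF_Sn n f) => x x0; rewrite -SF_rho f0 //; exact: S3_rho.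
exists (MkSF H); split=> [|x Sx]; last by rewrite /= sqrtr_gt0 f0.
by apply: SF_eq => x Sx; rewrite sfM /= -expr2 sqr_sqrtr // ltW // f0.
Qed.

End SphereFunctions.

(** * The invariant mean *)

Section UltraLimit.
Variables (R : realType) (U : set_system nat).
Hypothesis UF : UltraFilter U.
Implicit Types (s t : nat -> R) (B : R).

(** The image of an ultrafilter is an ultrafilter, and on the compact segment [-B, B] every
    ultrafilter converges. *)
Lemma ultra_cvg s B : (forall n, `|s n| <= B) -> cvg (s @ U).
Proof.
move=> sB.
have := @segment_compact R (- B) B; rewrite compact_ultra => K.
have UU : UltraFilter (s @ U).
  split; first exact: fmap_proper_filter.
  move=> G PG sG; apply/seteqP; split => // A GA.
  have [//|nA] := in_ultra_setVsetC (s @^-1` A) UF.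
  have := @filter_not_empty _ G _; rewrite -(setICr A); case.
  by apply: filterI => //; exact: sG.
have SB : U (s @^-1` `[- B, B]%classic).
  by apply: filterE => n; rewrite /= in_itv /= -ler_norml.
have [|l [_ sl]] := K _ UU.
  exact: SB.
exact: (cvgP l).
Qed.

Lemma ultra_lim_le s t : cvg (s @ U) -> cvg (t @ U) ->
  (forall n, s n <= t n) -> lim (s @ U) <= lim (t @ U).
Proof.
move=> cs ct st; apply: ler_lim => //.
exact: filterE.
Qed.

End UltraLimit.

Section PositivePart.
Variable R : realType.

Definition sqp (t : R) : R := Num.max 0 t ^+ 2.

(** The first-order Taylor remainder is at most h^2 in absolute value, whatever the signs of t and t
    + h. *)
Lemma is_derive_sqp (t : R) : is_derive t 1 sqp (2 * Num.max 0 t).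
Proof.
have E : h^-1 *: ((sqp \o shift t) (h *: (1 : R)) - sqp t) @[h --> 0^'] --> 2 * Num.max 0 t.
  apply/cvgrPdist_le => e e0.
  near=> h.
  have h0 : h != 0 by near: h; exact: nbhs_dnbhs_neq.
  have he : `|h| <= e.
    by near: h; exact: dnbhs0_le.
  apply: le_trans he.
  rewrite -(ler_pM2r (_ : 0 < `|h|)) ?normr_gt0 // -!normrM -expr2.
  rewrite (ger0_norm (sqr_ge0 h)) /shift /= [h *: (1 : R)]mulr1 /GRing.scale /=.
  have -> : (2 * Num.max 0 t - h^-1 * (sqp (h + t) - sqp t)) * h =
      2 * Num.max 0 t * h - (sqp (h + t) - sqp t) by field.
  rewrite /sqp.
  rewrite ler_norml; apply/andP; split.
    rewrite /Num.max; case: ltP => H1; case: ltP => H2; nra.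
  rewrite /Num.max; case: ltP => H1; case: ltP => H2; nra.
split; first by apply/cvg_ex; exists (2 * Num.max 0 t).
exact/cvg_lim.
Unshelve. all: by end_near. Qed.

Lemma continuous_pos (t : R) : {for t, continuous (fun s : R => Num.max 0 s)}.
Proof.
apply: (@continuous_max R R (fun=> 0) id); [exact: cst_continuous|exact: cvg_id].
Qed.

End PositivePart.

Section Cutoff.
Variable R : realType.
Local Notation V := 'rV[R]_4.
Implicit Types (x y v : V).

(* The cutoff is supported in the shell 1 <= |x| <= 2 and is only of class C^1. *)
Definition cutq x : R := (dot x x - 1) * (4 - dot x x).
Definition cutoff x : R := sqp (cutq x).

Lemma cutoff_ge0 x : 0 <= cutoff x.
Proof. exact: sqr_ge0. Qed.

Lemma cutoff_le9 x : cutoff x <= 9.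
Proof.
have q3 : cutq x <= 3.
  by rewrite /cutq; set d := dot x x; have := sqr_ge0 (d - 5 / 2); rewrite expr2; lra.
have : Num.max 0 (cutq x) <= 3 by rewrite ge_max q3 andbT.
have : 0 <= Num.max 0 (cutq x) by rewrite le_max lexx.
rewrite /cutoff /sqp; nra.
Qed.

Lemma cutoff0 x : dot x x <= 1 \/ 4 <= dot x x -> cutoff x = 0.
Proof.
move=> H; rewrite /cutoff /sqp max_l ?expr0n // /cutq.
by move: H; set d := dot x x => -[] H; nra.
Qed.

Lemma Sn_cutq n : Sn n (cutq : V -> R).
Proof.
rewrite (_ : cutq = ((fun x => dot x x) + cst (-1)) * (cst 4 + cst (-1) * (fun x : V => dot x x))).
  apply: Sn_M; apply: Sn_D; try exact: Sn_sqnorm; try exact: Sn_cst.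
  by apply: Sn_M; [exact: Sn_cst|exact: Sn_sqnorm].
by apply/funext => x; rewrite !fctE /cutq /cst mulN1r.
Qed.

Lemma diff_cutoff x : x != 0 -> differentiable cutoff x.
Proof.
move=> x0; apply: (@differentiable_comp _ _ _ _ cutq (@sqp R)).
  exact: (Sn_diff (Sn_cutq 0)).
by apply/derivable1_diffP; have [] := is_derive_sqp (cutq x).
Qed.

Lemma derive_cutoff x v : x != 0 ->
  'D_v cutoff x = 'D_v cutq x * (2 * Num.max 0 (cutq x)).
Proof.
move=> x0; have dq := Sn_diff (Sn_cutq 0) x0.
have ds : differentiable (@sqp R) (cutq x).
  by apply/derivable1_diffP; have [] := is_derive_sqp (cutq x).
rewrite (_ : cutoff = @sqp R \o cutq) // deriveE; last exact: differentiable_comp.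
rewrite diff_comp //= [in RHS]deriveE // diff1E // /GRing.scale /= derive1E.
by rewrite (@derive_val _ _ _ _ _ _ _ (is_derive_sqp (cutq x))).
Qed.

Lemma derive_cutq_tangent x v : x != 0 -> dot x v = 0 -> 'D_v cutq x = 0.
Proof.
move=> x0 xv; have ds : derivable (fun y : V => dot y y) x v.
  exact/diff_derivable/(Sn_diff (Sn_sqnorm R 0)).
have dc (c : R) : derivable (cst c : V -> R) x v := derivable_cst _ _ _.
have -> : cutq = ((fun x : V => dot x x) - cst 1) * (cst 4 - (fun x : V => dot x x)) by [].
rewrite (deriveM (derivableB ds (dc 1)) (derivableB (dc 4) ds)).
rewrite (deriveB ds (dc 1)) (deriveB (dc 4) ds) derive_sqnorm xv !derive_cst.
by rewrite mulr0 subrr !scaler0 addr0.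
Qed.

End Cutoff.

Section UniformContinuity.
Variables (R : realType) (V : normedModType R).

Lemma unif_continuous_line (G : V -> R) (K : set V) (v : V) (e : R) :
  compact K -> continuous G -> 0 < e ->
  \forall d \near (0 : R), forall x, K x -> forall s, `|s| <= `|d| ->
    `|G x - G (x + s *: v)| <= e.
Proof.
move=> cK cG e0.
apply: ((compact_near_coveringP K).1 cK R (nbhs 0)
  (fun d x => forall s, `|s| <= `|d| -> `|G x - G (x + s *: v)| <= e)) => x _.
have e2 : 0 < e / 2 by rewrite divr_gt0.
have /nbhs_normP [r /= r0 P] : \forall y \near x, `|G x - G y| < e / 2.
  by move: (cG x) => /cvgrPdist_lt/(_ _ e2).
have r2 : 0 < r / 2 by rewrite divr_gt0.
have V0 : 0 < `|v| + 1 by rewrite ltr_wpDl.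
have Hd : \forall d \near (0 : R), `|d| < r / 2 / (`|v| + 1).
  by apply: nbhs0_lt; rewrite divr_gt0.
near=> x' d => s sd.
have xx' : `|x - x'| < r / 2.
  by near: x'; apply/nbhs_normP; exists (r / 2).
have dr : `|d| < r / 2 / (`|v| + 1).
  by near: d; exact: Hd.
have sv : `|s *: v| < r / 2.
  rewrite normrZ; apply: le_lt_trans (_ : `|d| * (`|v| + 1) < _).
    by apply: ler_pM => //; rewrite lerDl.
  by rewrite -ltr_pdivlMr.
have H1 : `|G x - G x'| < e / 2.
  by apply: P => /=; apply: lt_trans xx' _; rewrite ltr_pdivrMr // ltr_pMr // ltr1n.
have H2 : `|G x - G (x' + s *: v)| < e / 2.
  apply: P => /=; rewrite opprD addrA.
  by apply: le_lt_trans (ler_normB _ _) _; rewrite [ltRHS]splitr ltrD.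
have -> : G x' - G (x' + s *: v) = (G x - G (x' + s *: v)) - (G x - G x') by ring.
by apply: le_trans (ler_normB _ _) _; rewrite [leRHS]splitr lerD // ltW.
Unshelve. all: by end_near. Qed.

End UniformContinuity.

(** * Riemann sums over a periodic grid *)

Section Grid.
Variable R : realType.
Local Notation V := 'rV[R]_4.

(* The factor 40 makes [3/5, 9/10] a union of grid cells, see [gsum_cutoff]. *)
Definition gridN (n : nat) : nat := 40 * n.+1.
Local Notation N := gridN.

Lemma gridN_gt0 n : 0 < (N n)%:R :> R.
Proof. by rewrite ltr0n. Qed.

Definition gpt n (z : {ffun 'I_4 -> 'I_(N n)}) : V :=
  \row_j (-2 + 4 * (z j)%:R / (N n)%:R).

(* Riemann sum over [-2, 2]^4, with opposite faces identified by [gshift]. *)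
Definition gsum n (F : V -> R) : R := (N n)%:R ^- 4 * \sum_z F (@gpt n z).

Definition gshift n (i : 'I_4) (z : {ffun 'I_4 -> 'I_(N n)}) : {ffun 'I_4 -> 'I_(N n)} :=
  [ffun j => if j == i then ordS (z j) else z j].

Lemma gshift_inj n i : injective (@gshift n i).
Proof.
move=> z z' /ffunP E; apply/ffunP => j; have := E j; rewrite !ffunE.
by case: eqP => // _ /(bij_inj (@ordS_bij _)).
Qed.

Lemma coord_dot (x : V) i : x 0 i ^+ 2 = 4 -> 4 <= dot x x.
Proof.
move=> xi; rewrite /dot (bigD1 i) //= -expr2 xi lerDl.
by apply: sumr_ge0 => j _; rewrite -expr2 sqr_ge0.
Qed.

(** The shift agrees with the cyclic shift of indices except at the last layer, where the two points
    have i-th coordinate 2 and -2; F vanishes at both. *)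
Lemma gsum_shift n i (F : V -> R) : (forall x, 4 <= dot x x -> F x = 0) ->
  \sum_z F (@gpt n z + (4 / (N n)%:R) *: std_basis R i) = \sum_z F (@gpt n z).
Proof.
move=> F0; rewrite [RHS](reindex_inj (@gshift_inj n i)) /=.
apply: eq_bigr => z _.
have Nn0 : (N n)%:R != 0 :> R by rewrite gt_eqF // gridN_gt0.
have [lt|ge] := ltnP (z i).+1 (N n).
  congr F; apply/rowP => j; rewrite !mxE ffunE eqxx /=.
  case: eqP => [->|_]; last by rewrite mulr0 addr0.
  by rewrite /= modn_small // mulr1 -addrA -mulrDl -(natr1 (z i)) mulrDr mulr1.
have zi : (z i).+1 = N n by apply/eqP; rewrite eqn_leq ge ltn_ord.
rewrite !F0 //; apply: (@coord_dot _ i); rewrite !mxE.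
  by rewrite ffunE eqxx /= zi modnn mulr0 mul0r addr0; ring.
rewrite !eqxx mulr1 -addrA -mulrDl -{2}(mulr1 4) -mulrDr natr1 zi mulfK //.
by ring.
Qed.

Lemma gsum_le n (F G : V -> R) : (forall x, F x <= G x) -> gsum n F <= gsum n G.
Proof.
move=> FG; rewrite /gsum ler_wpM2l ?invr_ge0 ?exprn_ge0 ?ler0n //.
by apply: ler_sum => z _.
Qed.

Lemma gsum_lin n (c : R) (F G : V -> R) :
  gsum n (fun x => c * F x + G x) = c * gsum n F + gsum n G.
Proof. by rewrite /gsum big_split /= -mulr_sumr mulrDr mulrCA. Qed.

Lemma gsum_norm n (F : V -> R) (e : R) :
  (forall z, `|F (@gpt n z)| <= e) -> `|gsum n F| <= e.
Proof.
move=> Fe; rewrite /gsum normrM ger0_norm ?invr_ge0 ?exprn_ge0 ?ler0n //.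
rewrite mulrC ler_pdivrMr ?exprn_gt0 ?gridN_gt0 //.
apply: le_trans (ler_norm_sum _ _ _) _.
apply: le_trans (ler_sum _ (fun z _ => Fe z)) _.
by rewrite sumr_const card_ffun !card_ord -natrX mulr_natr.
Qed.

Definition box : set V := [set x | forall i, -2 <= x 0 i <= 2].

Lemma box_compact : compact box.
Proof.
have := @rV_compact R 4 (fun=> `[-2, 2]%classic) (fun _ => @segment_compact R _ _).
by congr compact; apply/seteqP; split => x /= H i; have := H i; rewrite in_itv.
Qed.

Lemma gpt_box n z : box (@gpt n z).
Proof.
move=> i; rewrite mxE; have Nn := gridN_gt0 n.
have z0 : 0 <= 4 * (z i)%:R / (N n)%:R :> R by rewrite divr_ge0 ?mulr_ge0 ?ler0n.
have z4 : 4 * (z i)%:R / (N n)%:R <= 4 :> R.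
  by rewrite ler_pdivrMr // ler_pM2l // ler_nat ltnW.
by apply/andP; split; lra.
Qed.

Lemma gridN_cvg (e : R) : 0 < e -> \forall n \near \oo, 4 / (N n)%:R < e.
Proof.
move=> e0; near=> n.
rewrite ltr_pdivrMr ?gridN_gt0 // -ltr_pdivrMl // mulrC.
apply: le_lt_trans (_ : n%:R < _); last by rewrite ltr_nat /gridN; lia.
by near: n; exact: nbhs_infty_ger.
Unshelve. all: by end_near. Qed.

(** Difference quotients with step equal to the mesh sum to zero by [gsum_shift]. They differ from
    the partial derivative by a uniformly small amount, by the mean value theorem and uniform
    continuity on the box. *)
Lemma gsum_partial i (F : V -> R) : (forall x, differentiable F x) ->
  continuous (partial i F) -> (forall x, 4 <= dot x x -> F x = 0) ->
  gsum n (partial i F) @[n --> \oo] --> 0.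
Proof.
move=> dF cF F0; apply/cvgrPdist_le => e e0.
have /nbhs_normP [r /= r0 P] :=
  unif_continuous_line (std_basis R i) box_compact cF e0.
near=> n.
have hr : 4 / (N n)%:R < r by near: n; exact: gridN_cvg.
set h : R := 4 / (N n)%:R in hr *.
have h0 : 0 < h by rewrite divr_gt0 ?gridN_gt0.
have -> : gsum n (partial i F) =
    gsum n (fun x => partial i F x - h^-1 * (F (x + h *: std_basis R i) - F x)).
  rewrite /gsum; congr (_ * _); rewrite big_split /= -[LHS]addr0; congr (_ + _).
  by rewrite sumrN -mulr_sumr sumrB gsum_shift // subrr mulr0 oppr0.
rewrite sub0r normrN; apply: gsum_norm => z.
have [s /andP[s0 sh] ->] := @line_MVT R V F (gpt z) (std_basis R i) h (ltW h0) (fun s _ => dF _).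
rewrite mulrC mulfK ?gt_eqF //.
apply: (P h) => //; first by rewrite /= ?sub0r ?normrN gtr0_norm.
  exact: gpt_box.
by rewrite !ger0_norm // ltW.
Unshelve. all: by end_near. Qed.

Lemma card_ord_range (m a b : nat) : (b <= m)%N ->
  (b - a <= #|[pred k : 'I_m | (a <= k < b)%N]|)%N.
Proof.
move=> bm.
have Hk (k : 'I_(b - a)) : (a + k < m)%N by have := ltn_ord k; lia.
pose g k : 'I_m := Ordinal (Hk k).
have gi : injective g by move=> k l /(congr1 val) /= /addnI /val_inj.
rewrite -[X in (X <= _)%N]card_ord -(card_codom gi); apply: subset_leq_card.
apply/fintype.subsetP => _ /codomP [k ->]; rewrite inE /=.
by have := ltn_ord k; lia.
Qed.

(** Only grid points with all coordinates in [3/5, 9/10] are counted. They make up at least a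
    fraction (3/40)^4 of the grid, lie well inside the shell, and have [cutq] at least 3/10
    there. *)
Lemma gsum_cutoff n : (3 / 40) ^+ 4 * (9 / 100) <= gsum n (@cutoff R).
Proof.
pose A := [pred k : 'I_(N n) | (26 * n.+1 <= k < 29 * n.+1)%N].
have cA : (3 * n.+1 <= #|A|)%N.
  apply: leq_trans (card_ord_range _ _); first by rewrite -mulnBl.
  by rewrite leq_mul2r orbT.
rewrite /gsum [leRHS]mulrC ler_pdivlMr ?exprn_gt0 ?gridN_gt0 //.
rewrite (bigID (fun z => z \in ffun_on A)) /=.
apply: ler_wpDr; first by apply: sumr_ge0 => z _; exact: cutoff_ge0.
apply: le_trans (_ : \sum_(z in ffun_on A) (9 / 100) <= _); last first.
  apply: ler_sum => z /ffun_onP zA.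
  have zj j : 3 / 5 <= @gpt n z 0 j <= 9 / 10.
    have := zA j; rewrite inE mxE => /andP[z1 z2]; have Nn := gridN_gt0 n.
    have z1' : 26 * (n.+1)%:R <= (z j)%:R :> R by rewrite -natrM ler_nat.
    have z2' : (z j)%:R <= 29 * (n.+1)%:R :> R by rewrite -natrM ler_nat ltnW.
    have NE : (N n)%:R = 40 * (n.+1)%:R :> R by rewrite /gridN natrM.
    have q1 : 26 / 10 <= 4 * (z j)%:R / (N n)%:R :> R.
      by rewrite ler_pdivlMr // NE; lra.
    have q2 : 4 * (z j)%:R / (N n)%:R <= 29 / 10 :> R.
      by rewrite ler_pdivrMr // NE; lra.
    by apply/andP; split; lra.
  have sq j : 36 / 100 <= @gpt n z 0 j * @gpt n z 0 j <= 81 / 100.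
    by have := zj j; set t := gpt z 0 j => /andP[t1 t2]; apply/andP; split; nra.
  have d1 : 144 / 100 <= dot (gpt z) (gpt z).
    apply: le_trans (_ : \sum_(j < 4) (36 / 100) <= _).
      by rewrite sumr_const card_ord; lra.
    by apply: ler_sum => j _; have /andP[] := sq j.
  have d2 : dot (gpt z) (gpt z) <= 324 / 100.
    apply: le_trans (_ : \sum_(j < 4) (81 / 100) <= _).
      by apply: ler_sum => j _; have /andP[] := sq j.
    by rewrite sumr_const card_ord; lra.
  have q0 : 3 / 10 <= cutq (gpt z).
    by rewrite /cutq; move: d1 d2; set d := dot _ _ => d1 d2; nra.
  have : 3 / 10 <= Num.max 0 (cutq (gpt z)) by rewrite le_max q0 orbT.
  by rewrite /cutoff /sqp; set t := Num.max _ _ => t3; nra.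
rewrite sumr_const card_ffun_on card_ord -[leRHS]mulr_natr mulrAC [leRHS]mulrC.
have A3 : 3 / 40 * (N n)%:R <= #|A|%:R :> R.
  apply: le_trans (_ : (3 * n.+1)%:R <= _); last by rewrite ler_nat.
  by rewrite /gridN !natrM; lra.
rewrite ler_wpM2r // -exprMn natrX lerXn2r ?nnegrE ?mulr_ge0 ?ler0n //.
Qed.

End Grid.

Section NearContinuity.
Variables (R : realType) (W : normedModType R).
Implicit Types (F G : W -> R) (x : W).

Lemma near_eq_continuous F G x :
  (\forall y \near x, F y = G y) -> {for x, continuous F} -> {for x, continuous G}.
Proof.
move=> H /cvgrPdist_le cF; apply/cvgrPdist_le => e e0.
rewrite -(nbhs_singleton H).
by apply: filterS2 H (cF e e0) => y ->.
Qed.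

Lemma continuous_mul F G x : {for x, continuous F} -> {for x, continuous G} ->
  {for x, continuous (fun y => F y * G y)}.
Proof. by move=> cF cG; apply: cvgM; [exact: cF|exact: cG]. Qed.

Lemma continuous_add F G x : {for x, continuous F} -> {for x, continuous G} ->
  {for x, continuous (fun y => F y + G y)}.
Proof. by move=> cF cG; apply: cvgD; [exact: cF|exact: cG]. Qed.

End NearContinuity.

(** * Construction of the mean *)

Section Mean.
Variable R : realType.
Local Notation V := 'rV[R]_4.
Local Notation SF := (SF R).
Local Notation M := (qmx R).
Implicit Types (x y : V) (F G : V -> R).

Lemma diff_sqnorm x : differentiable (fun y => dot y y) x.
Proof.
have D : differentiable (\sum_(i < 4) (fun y : V => y 0 i) * (fun y : V => y 0 i) : V -> R) x.
  elim/big_ind : _ => [|f g df dg|k _]; first exact: differentiable_cst.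
    exact: (differentiableD df dg).
  exact: (differentiableM (differentiable_coord x 0 k) (differentiable_coord x 0 k)).
by rewrite sqnorm_sumE.
Qed.

Lemma near0_sqnorm : \forall x \near (0 : V), dot x x <= 1.
Proof.
have c0 := differentiable_continuous (diff_sqnorm 0).
have d0 : dot (0 : V) 0 = 0 by apply/eqP; rewrite dot_eq0.
have := c0; move=> /cvgrPdist_le/(_ 1 ltr01).
rewrite d0; apply: filterS => x.
by rewrite sub0r normrN ger0_norm // dot_ge0.
Qed.

Lemma S3_bounded (f : SF) : exists B, forall x, S3 x -> `|f x| <= B.
Proof.
have cS : compact (@S3 R).
  apply: (subclosed_compact _ (@box_compact R)).
    have -> : @S3 R = (fun y => dot y y) @^-1` [set 1].
      apply/seteqP; split => x /=; first exact: S3_dot.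
      by rewrite /S3 /= /enorm => ->; rewrite sqrtr1.
    apply: closed_comp => [x _|]; first exact/differentiable_continuous/diff_sqnorm.
    exact: closed_eq.
  move=> x Sx i; have := normr_dot_le x (std_basis R i).
  rewrite dot_std_basis S3_std_basis Sx mulr1 ler_norml => /andP[? ?].
  by apply/andP; split; lra.
have S0 : @S3 R !=set0 by exists (std_basis R 0); exact: S3_std_basis.
have cf : {within @S3 R, continuous (fun x => `|f x|)}.
  apply: continuous_in_subspaceT => x; rewrite inE => /S3_neq0 x0.
  apply: continuous_comp; last exact: norm_continuous.
  exact/differentiable_continuous/SF_diff.
have [c _ cm] := EVT_max_rV S0 cS cf.
by exists `|f c| => x Sx; apply: cm; rewrite inE.
Qed.

Section CutoffProduct.
Variables (g : V -> R) (i : 'I_4).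
Hypothesis sg : forall n, Sn n g.

Let Phi := @cutoff R * g.

Let Phi0 : \forall x \near (0 : V), Phi x = 0.
Proof.
apply: filterS near0_sqnorm => x x1; rewrite /Phi !fctE cutoff0 ?mul0r //; by left.
Qed.

Let zero_near0 : \forall x \near (0 : V), \forall y \near x, Phi y = 0.
Proof. exact: (near_join Phi0). Qed.

(** The factor g is controlled only off the origin, but the cutoff vanishes in a whole neighbourhood
    of it; the product is therefore differentiable everywhere. *)
Lemma diff_cutoff_mul x : differentiable Phi x.
Proof.
have [->|x0] := eqVneq x 0; last first.
  by apply: differentiableM; [exact: diff_cutoff|exact: (Sn_diff (sg 0))].
apply: (near_eq_differentiable (f := cst 0)); last exact: differentiable_cst.
by apply: filterS Phi0 => y ->.
Qed.

Lemma partial_cutoff_mul x : x != 0 -> partial i Phi x =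
  cutoff x * partial i g x + g x * partial i (@cutoff R) x.
Proof.
by move=> x0; rewrite partialM //; [exact: diff_cutoff|exact: (Sn_diff (sg 0))].
Qed.

Lemma partial_near0 : \forall x \near (0 : V), partial i Phi x = 0.
Proof.
apply: filterS zero_near0 => x Px; rewrite /partial.
rewrite (@near_eq_derive R V R Phi (cst 0)) ?derive_cst //.
Qed.

Lemma continuous_partial_cutoff_mul : continuous (partial i Phi).
Proof.
move=> x; have [->|x0] := eqVneq x 0.
  apply: (near_eq_continuous (F := cst 0)); last exact: cst_continuous.
  by apply: filterS partial_near0 => y ->.
have E : \forall y \near x, partial i Phi y =
    cutoff y * partial i g y + g y * (partial i (@cutq R) y * (2 * Num.max 0 (cutq y))).
  apply: filterS (near_neq0 x0) => y y0.
  by rewrite partial_cutoff_mul // {2}/partial derive_cutoff.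
apply: (near_eq_continuous (F := fun y => cutoff y * partial i g y
  + g y * (partial i (@cutq R) y * (2 * Num.max 0 (cutq y))))).
  by apply: filterS E => y ->.
have cq := differentiable_continuous (Sn_diff (Sn_cutq R 0) x0).
have cpq := differentiable_continuous (proj1 (proj2 (Sn_cutq R 1) i) x x0).
have cg := differentiable_continuous (Sn_diff (sg 0) x0).
have cpg := differentiable_continuous (proj1 (proj2 (sg 1) i) x x0).
have cc := differentiable_continuous (diff_cutoff x0).
apply: continuous_add; apply: continuous_mul; [exact: cc|exact: cpg|exact: cg|].
apply: continuous_mul; first exact: cpq.
apply: continuous_mul; first exact: cst_continuous.
exact: (@continuous_comp _ _ _ (@cutq R) (fun s => Num.max 0 s) x cq (@continuous_pos R (cutq x))).
Qed.

Lemma gsum_cutoff_mul : gsum n (partial i Phi) @[n --> \oo] --> 0.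
Proof.
apply: gsum_partial; [exact: diff_cutoff_mul|exact: continuous_partial_cutoff_mul|].
move=> x x4; rewrite /Phi !fctE cutoff0 ?mul0r //; by right.
Qed.

End CutoffProduct.

(* The field x *m M a is divergence free and tangent to the level sets of the
   cutoff. *)
Lemma cutoff_div (a : 'I_3) (f : SF) x :
  cutoff x * sX a f (rho x) =
  \sum_(i < 4) partial i (@cutoff R * ((fun y => (y *m M a) 0 i) * f)) x.
Proof.
have sg i n : Sn n ((fun y => (y *m M a) 0 i) * f : V -> R).
  by apply: Sn_M; [exact: Sn_lin|exact: SF_Sn].
rewrite SF_rho; have [->|x0] := eqVneq x 0.
  rewrite cutoff0 ?mul0r; last by left; exact: (nbhs_singleton near0_sqnorm).
  by rewrite big1 // => i _; exact: (nbhs_singleton (partial_near0 _ i)).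
have df := SF_diff f x0.
rewrite sX_neq0 // (derive_partial _ df) mulr_sumr.
have H0 : \sum_(i < 4) (x *m M a) 0 i * partial i (@cutoff R) x = 0.
  rewrite -derive_partial; last exact: diff_cutoff.
  by rewrite derive_cutoff // derive_cutq_tangent ?dot_qmx // mul0r.
have E i : partial i (@cutoff R * ((fun y => (y *m M a) 0 i) * f)) x =
    cutoff x * ((x *m M a) 0 i * partial i f x)
    + f x * ((x *m M a) 0 i * partial i (@cutoff R) x).
  rewrite (partial_cutoff_mul i (sg i) x0) partialM //; last exact: (Sn_diff (Sn_lin R 0 a i)).
  by rewrite partial_lin qmx_diag mulr0 addr0 !fctE; congr (_ + _); ring.
transitivity (\sum_(i < 4) (cutoff x * ((x *m M a) 0 i * partial i f x)
    + f x * ((x *m M a) 0 i * partial i (@cutoff R) x))).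
  by rewrite big_split /= -[X in _ = _ + X]mulr_sumr H0 mulr0 addr0.
by apply: eq_bigr => i _; rewrite E.
Qed.

Definition bS F := exists B, forall x, S3 x -> `|F x| <= B.

(** The last clause is infinitesimal invariance; it is the source of every integration by parts
    below. *)
Definition is_mean (A : (V -> R) -> R) := [/\ A (cst 1) = 1,
  forall c F G, bS F -> bS G -> A (fun x => c * F x + G x) = c * A F + A G,
  forall F G, bS F -> bS G -> (forall x, S3 x -> F x <= G x) -> A F <= A G &
  forall a (f : SF), A (sX a f) = 0].

(** The limit of Riemann sums of the cutoff times the degree 0 extension, normalized by its value at
    1, which [gsum_cutoff] keeps away from 0. Invariance holds because the summand for [sX a f] is a
    sum of partial derivatives, by [cutoff_div]. *)
Lemma ex_mean : exists A, is_mean A.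
Proof.
have [U [UU sU]] := @ultraFilterLemma nat \oo _.
pose T F n := gsum n (fun x => cutoff x * F (rho x)).
have TB F : bS F -> cvg (T F @ U).
  move=> [B FB]; apply: (@ultra_cvg R U UU _ (9 * B)) => n.
  apply: gsum_norm => z; rewrite normrM; apply: ler_pM => //.
    by rewrite ger0_norm ?cutoff_ge0 // cutoff_le9.
  exact/FB/S3_rho.
have b1 : bS (cst 1) by exists 1 => x _; rewrite normr1.
set c0 : R := (3 / 40) ^+ 4 * (9 / 100).
have cp : 0 < c0 by rewrite /c0 mulr_gt0 ?exprn_gt0 //; lra.
have L1 : c0 <= lim (T (cst 1) @ U).
  have cc : cvg ((fun _ : nat => c0) @ U) by exact: is_cvg_cst.
  have := ultra_lim_le UU cc (TB _ b1).
  rewrite lim_cst; last exact: norm_hausdorff.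
  apply => n; apply: le_trans (@gsum_cutoff R n) _.
  by apply: gsum_le => x; rewrite /cst mulr1.
have L0 : 0 < lim (T (cst 1) @ U) by exact: lt_le_trans L1.
exists (fun F => lim (T F @ U) / lim (T (cst 1) @ U)); split.
- by rewrite divff // gt_eqF.
- move=> c F G bF bG.
  have -> : T (fun x => c * F x + G x) = (fun n => c * T F n + T G n).
    apply/funext => n; rewrite /T -gsum_lin; congr gsum; apply/funext => x; ring.
  have -> : lim ((fun n => c * T F n + T G n) @ U) = c * lim (T F @ U) + lim (T G @ U).
    apply/cvg_lim; first exact: norm_hausdorff.
    apply: cvgD; last exact: TB.
    by apply: cvgM; [exact: cvg_cst|exact: TB].
  by rewrite mulrDl mulrA.
- move=> F G bF bG FG; rewrite ler_wpM2r ?invr_ge0 ?(ltW L0) //.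
  apply: (ultra_lim_le UU); [exact: TB|exact: TB|] => n; apply: gsum_le => x.
  by rewrite ler_wpM2l ?cutoff_ge0 // FG //; exact: S3_rho.
- move=> a f.
  have -> : T (sX a f) = (fun n =>
      \sum_(i < 4) gsum n (partial i (@cutoff R * ((fun y => (y *m M a) 0 i) * f)))).
    apply/funext => n; rewrite /T /gsum -mulr_sumr; congr (_ * _).
    by rewrite exchange_big /=; apply: eq_bigr => z _; rewrite cutoff_div.
  have H i : gsum n (partial i (@cutoff R * ((fun y => (y *m M a) 0 i) * f))) @[n --> U] --> 0.
    have sg n : Sn n ((fun y : V => (y *m M a) 0 i) * f : V -> R).
      by apply: Sn_M; [exact: Sn_lin|exact: SF_Sn].
    move=> A /(gsum_cutoff_mul i sg) HA; exact: (sU _ HA).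
  have -> : lim ((fun n =>
      \sum_(i < 4) gsum n (partial i (@cutoff R * ((fun y => (y *m M a) 0 i) * f)))) @ U) = 0.
    apply/cvg_lim; first exact: norm_hausdorff.
    under eq_fun do rewrite !big_ord_recl big_ord0.
    have K i j k l := cvgD (H i) (cvgD (H j) (cvgD (H k) (cvgD (H l) (cvg_cst (0 : R))))).
    by move: K; rewrite !addr0; apply.
  by rewrite mul0r.
Qed.

End Mean.

(** * The Paneitz operator *)

Section Laplacian.
Variable R : realType.
Local Notation V := 'rV[R]_4.
Local Notation SF := (SF R).
Local Notation M := (qmx R).
Implicit Types (f g h u : SF) (x p : V) (c : R) (a b : 'I_3).

Lemma sX_inv a u h : u * h = 1 -> sX a h = - (h * h * sX a u).
Proof.
move=> uh; have : sX a (u * h) = 0 by rewrite uh sX1.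
rewrite sXM => /(congr1 (fun f => h * f));
rewrite mulr0 mulrDr [h * (u * _)]mulrA (mulrC h u) uh mul1r.
by rewrite addrC => /eqP; rewrite addr_eq0 => /eqP ->; ring.
Qed.

(** The Casimir operator of the frame; [laplace_beltramiE] identifies it with the Laplace-Beltrami
    operator. The form [gam] below is its carré du champ, the scalar product of gradients. *)
Definition lap f : SF := sX 0 (sX 0 f) + sX 1 (sX 1 f) + sX 2 (sX 2 f).
Definition gam f g : SF := sX 0 f * sX 0 g + sX 1 f * sX 1 g + sX 2 f * sX 2 g.

Lemma gamC f g : gam f g = gam g f.
Proof. by rewrite /gam; ring. Qed.

Lemma sX_mul2 a f : sX a (2 * f) = 2 * sX a f.
Proof. by rewrite !mulr_natl !mulr2n sXD. Qed.

Lemma lapD f g : lap (f + g) = lap f + lap g.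
Proof. by rewrite /lap !sXD; ring. Qed.

Lemma lapZ c f : lap (sfc c * f) = sfc c * lap f.
Proof. by rewrite /lap !sXZ; ring. Qed.

Lemma lapN f : lap (- f) = - lap f.
Proof. by rewrite /lap !sXN; ring. Qed.

Lemma lapM f g : lap (f * g) = lap f * g + f * lap g + 2 * gam f g.
Proof. by rewrite /lap /gam !(sXM, sXD); ring. Qed.

(** Commuting X_a past the squares of the two other fields produces the same anticommutator twice,
    with opposite signs. *)
Lemma sX_lap a f : sX a (lap f) = lap (sX a f).
Proof.
have [[C01 C12] C20] : ((forall g, sX 0 (sX 1 g) = sX 1 (sX 0 g) + 2 * sX 2 g) *
   (forall g, sX 1 (sX 2 g) = sX 2 (sX 1 g) + 2 * sX 0 g) *
   (forall g, sX 2 (sX 0 g) = sX 0 (sX 2 g) + 2 * sX 1 g)).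
  by do !split; move=> g; have [[? ?] ?] := sX_comms g.
move: a; apply: ord3E; rewrite /lap !sXD.
- have -> : sX 0 (sX 1 (sX 1 f)) = sX 1 (sX 1 (sX 0 f)) + 2 * sX 1 (sX 2 f) + 2 * sX 2 (sX 1 f).
    by rewrite C01 (C01 f) sXD sX_mul2.
  have -> : sX 2 (sX 2 (sX 0 f)) = sX 0 (sX 2 (sX 2 f)) + 2 * sX 1 (sX 2 f) + 2 * sX 2 (sX 1 f).
    by rewrite (C20 f) sXD sX_mul2 C20.
  by ring.
- have -> : sX 1 (sX 2 (sX 2 f)) = sX 2 (sX 2 (sX 1 f)) + 2 * sX 2 (sX 0 f) + 2 * sX 0 (sX 2 f).
    by rewrite C12 (C12 f) sXD sX_mul2.
  have -> : sX 0 (sX 0 (sX 1 f)) = sX 1 (sX 0 (sX 0 f)) + 2 * sX 2 (sX 0 f) + 2 * sX 0 (sX 2 f).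
    by rewrite (C01 f) sXD sX_mul2 C01.
  by ring.
- have -> : sX 2 (sX 0 (sX 0 f)) = sX 0 (sX 0 (sX 2 f)) + 2 * sX 0 (sX 1 f) + 2 * sX 1 (sX 0 f).
    by rewrite C20 (C20 f) sXD sX_mul2.
  have -> : sX 1 (sX 1 (sX 2 f)) = sX 2 (sX 1 (sX 1 f)) + 2 * sX 0 (sX 1 f) + 2 * sX 1 (sX 0 f).
    by rewrite (C12 f) sXD sX_mul2 C12.
  by ring.
Qed.

Lemma sy_opp p : sy (- p) = - sy p.
Proof. by apply: SF_eq => x Sx; rewrite sfN !syE // dotNl. Qed.

Lemma sXX_y a b p : sX b (sX a (sy p)) = sy (p *m M a *m M b).
Proof. by rewrite sX_y sXN sX_y opprK. Qed.

Lemma lap_y p : lap (sy p) = - (3 * sy p).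
Proof. by rewrite /lap !sXX_y !qmx_sqr !sy_opp; ring. Qed.

(* The conformal vector field grad y, for y = <., p>. *)
Definition cY p f : SF := gam (sy p) f.

(** This is Bochner's formula with Hess y = - y g and Ric = 2 g: the zeroth-order change is -3 from
    the eigenvalue of y plus 4 from the curvature. Here it is verified in the frame. *)
Lemma lap_cY p f : lap (cY p f) = cY p (lap f) - 2 * (sy p * lap f) + cY p f.
Proof.
have E a : lap (sX a (sy p) * sX a f) =
    - (3 * (sX a (sy p) * sX a f)) + sX a (sy p) * sX a (lap f)
    + 2 * gam (sX a (sy p)) (sX a f).
  by rewrite lapM -!sX_lap lap_y sXN !mulr_natl mulrSr mulr2n !sXD; ring.
rewrite /cY {1}/gam !lapD !E /gam.
have Y0 : sX 0 (sX 1 (sy p)) = sX 2 (sy p) by rewrite sXX_y !qmx_mul sy_opp sX_y.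
have Y1 : sX 1 (sX 0 (sy p)) = - sX 2 (sy p) by rewrite sXX_y !qmx_mul sX_y opprK.
have Y2 : sX 1 (sX 2 (sy p)) = sX 0 (sy p) by rewrite sXX_y !qmx_mul sy_opp sX_y.
have Y3 : sX 2 (sX 1 (sy p)) = - sX 0 (sy p) by rewrite sXX_y !qmx_mul sX_y opprK.
have Y4 : sX 2 (sX 0 (sy p)) = sX 1 (sy p) by rewrite sXX_y !qmx_mul sy_opp sX_y.
have Y5 : sX 0 (sX 2 (sy p)) = - sX 1 (sy p) by rewrite sXX_y !qmx_mul sX_y opprK.
have Y6 a : sX a (sX a (sy p)) = - sy p by rewrite sXX_y qmx_sqr sy_opp.
rewrite !Y0 !Y1 !Y2 !Y3 !Y4 !Y5 !Y6.
have [[-> ->] ->] := sX_comms f.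
by rewrite /lap; ring.
Qed.

Definition pan f : SF := lap (lap f) + sfc (1 / 2) * lap f - sfc (15 / 16) * f.

Lemma sX_pan a f : pan (sX a f) = sX a (pan f).
Proof. by rewrite /pan 2!sXD sXN 2!sXZ !sX_lap. Qed.

(** * Integration by parts and the Kazdan-Warner identity *)

Section MeanValue.
Variable A : (V -> R) -> R.
Hypothesis hA : is_mean A.

Lemma bS_SF f : bS f. Proof. exact: S3_bounded. Qed.

Definition SFmean f : R := A f.
Local Notation E := SFmean.

Lemma E_lin c f g : E (sfc c * f + g) = c * E f + E g.
Proof. by case: hA => _ L _ _; rewrite /SFmean -L //; exact: bS_SF. Qed.

Lemma E1 : E 1 = 1. Proof. by case: hA. Qed.

Lemma ED f g : E (f + g) = E f + E g.
Proof.
rewrite -[E f]mul1r -E_lin; congr (E (_ + _)).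
by apply: SF_eq => x _; rewrite !sfE mul1r.
Qed.

Lemma E0 : E 0 = 0.
Proof.
have := ED 0 0; rewrite addr0 => /eqP.
by rewrite -subr_eq0 opprD addrA subrr sub0r oppr_eq0 => /eqP.
Qed.

Lemma EZ c f : E (sfc c * f) = c * E f.
Proof. by rewrite -[LHS]addr0 -{1}E0 -ED -[E f]addr0 E_lin E0 !addr0. Qed.

Lemma EN f : E (- f) = - E f.
Proof. by rewrite -[RHS]mulN1r -EZ; congr E; apply: SF_eq => x _; rewrite !sfE mulN1r. Qed.

Lemma EM2 f : E (2 * f) = 2 * E f.
Proof. by rewrite mulr_natl mulr2n ED; ring. Qed.

Lemma EM3 f : E (3 * f) = 3 * E f.
Proof. by rewrite mulr_natl mulrSr mulr2n !ED; ring. Qed.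

Lemma E_le f g : (forall x, S3 x -> f x <= g x) -> E f <= E g.
Proof. by case: hA => _ _ L _ fg; apply: L => //; exact: bS_SF. Qed.

Lemma EX a f : E (sX a f) = 0. Proof. by case: hA => _ _ _; apply. Qed.

Lemma EX_parts a f g : E (sX a f * g) = - E (f * sX a g).
Proof. by apply/eqP; rewrite -addr_eq0 -ED -sXM EX. Qed.

Lemma E_gam f g : E (lap f * g) = - E (gam f g).
Proof.
rewrite /lap /gam 2!mulrDl 4!ED.
rewrite (EX_parts 0 (sX 0 f)) (EX_parts 1 (sX 1 f)) (EX_parts 2 (sX 2 f)).
by rewrite !opprD.
Qed.

Lemma E_lap_sym f g : E (lap f * g) = E (f * lap g).
Proof.
have H1 := E_gam f g.
have H2 := E_gam g f.
rewrite H1.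
rewrite (mulrC f (lap g)).
rewrite H2.
by rewrite (gamC g f).
Qed.

Lemma E_lap f : E (lap f) = 0.
Proof. by rewrite /lap !ED !EX !addr0. Qed.

Lemma E_pan_sym f g : E (pan f * g) = E (f * pan g).
Proof.
rewrite /pan.
have -> : (lap (lap f) + sfc (1 / 2) * lap f - sfc (15 / 16) * f) * g =
  lap (lap f) * g + sfc (1 / 2) * (lap f * g) - sfc (15 / 16) * (f * g) by ring.
have -> : f * (lap (lap g) + sfc (1 / 2) * lap g - sfc (15 / 16) * g) =
  f * lap (lap g) + sfc (1 / 2) * (f * lap g) - sfc (15 / 16) * (f * g) by ring.
by rewrite !ED !EN !EZ !E_lap_sym.
Qed.

Lemma E_pan f : E (pan f) = - (15 / 16) * E f.
Proof. by rewrite /pan 2!ED EN 2!EZ 2!E_lap; ring. Qed.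

(** Integration by parts along grad y, whose divergence is - 3 y. *)
Lemma E_cY p f g : E (cY p f * g) = 3 * E (sy p * f * g) - E (f * cY p g).
Proof.
have -> : cY p f * g = sX 0 f * (sX 0 (sy p) * g) + sX 1 f * (sX 1 (sy p) * g)
   + sX 2 f * (sX 2 (sy p) * g) by rewrite /cY /gam; ring.
rewrite !ED !EX_parts !sXM -!opprD -!ED -EM3.
have -> : f * (sX 0 (sX 0 (sy p)) * g + sX 0 (sy p) * sX 0 g) +
     f * (sX 1 (sX 1 (sy p)) * g + sX 1 (sy p) * sX 1 g) +
     f * (sX 2 (sX 2 (sy p)) * g + sX 2 (sy p) * sX 2 g) =
     lap (sy p) * f * g + f * cY p g by rewrite /cY /gam /lap; ring.
rewrite lap_y.
have -> : - (3 * sy p) * f * g = - (3 * (sy p * f * g)) by ring.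
by rewrite ED EN opprD opprK.
Qed.

Lemma E_cY_self p f : E (cY p f * f) = 3 / 2 * E (sy p * f * f).
Proof. by have := E_cY p f f; rewrite [f * cY p f]mulrC; lra. Qed.

(* With T = cY p + y/2, conformal covariance reads P T = (cY p - 7/2 y) P, and
   the right-hand factor is minus the adjoint of T; hence E (T u * P u) = 0. *)
Lemma pohozaev p u : E ((cY p u + sfc (1 / 2) * (sy p * u)) * pan u) = 0.
Proof.
set y := sy p; set v := lap u.
have -> : (cY p u + sfc (1 / 2) * (y * u)) * pan u =
    cY p u * lap v + sfc (1 / 2) * (cY p u * v) - sfc (15 / 16) * (cY p u * u)
    + sfc (1 / 2) * (y * u * lap v) + sfc (1 / 2) * (sfc (1 / 2) * (y * u * v))
    - sfc (1 / 2) * (sfc (15 / 16) * (y * u * u)) by rewrite /pan -/v; ring.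
rewrite !(ED, EN, EZ).
(* [F1] to [F6] are linear relations among nine means, obtained by moving the Laplacian and grad y
   across products. The claim is a linear consequence of them. *)
have F1 : E (cY p u * lap v) = E (cY p v * v) - 2 * E (y * v * v) + E (cY p u * v).
  rewrite -E_lap_sym lap_cY -/v -/y.
  have -> : (cY p v - 2 * (y * v) + cY p u) * v = cY p v * v - 2 * (y * v * v) + cY p u * v by ring.
  by rewrite !ED EN EM2.
have F2 := E_cY_self p v.
have F3 : E (y * u * lap v) = - 3 * E (y * u * v) + E (y * v * v) + 2 * E (cY p u * v).
  rewrite -E_lap_sym lapM lap_y -/v -/y -/(cY p u).
  have -> : (- (3 * y) * u + y * v + 2 * cY p u) * v =
    - (3 * (y * u * v)) + y * v * v + 2 * (cY p u * v) by ring.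
  by rewrite !ED EN EM3 EM2; ring.
have F4 : E (cY p u * v) = E (cY p v * u) - 2 * E (y * u * v) + E (cY p u * u).
  rewrite {1}/v -E_lap_sym lap_cY -/v -/y.
  have -> : (cY p v - 2 * (y * v) + cY p u) * u = cY p v * u - 2 * (y * u * v) + cY p u * u by ring.
  by rewrite !ED EN EM2.
have F5 : E (cY p v * u) = 3 * E (y * u * v) - E (cY p u * v).
  rewrite E_cY -/y [v * cY p u]mulrC; congr (3 * E _ - _); ring.
have F6 := E_cY_self p u.
rewrite -/y in F2 F6 *.
move: F1 F2 F3 F4 F5 F6.
generalize (E (cY p u * lap v)) (E (cY p v * v)) (E (y * v * v)) (E (cY p u * v))
  (E (y * u * lap v)) (E (y * u * v)) (E (cY p v * u)) (E (cY p u * u)) (E (y * u * u)).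
by move=> *; lra.
Qed.

(** The exponent -7 is the invariant one. From Y (h^6) = - 6 h^7 Y u and the divergence of Y one
    gets E (h^7 Y u) = - E (y h^6) / 2, which cancels the contribution of y u / 2. The linear term
    leaves - eps (3/2 + 1/2) E (y u^2). *)
Lemma kazdan_warner p (eps : R) u h : 0 < eps -> u * h = 1 ->
  pan u = - (h ^+ 7 + sfc eps * u) -> E (sy p * u * u) = 0.
Proof.
move=> eps0 uh eqn; have := pohozaev p u; rewrite eqn.
set y := sy p; set Yu := cY p u.
have Xh a := sX_inv a uh.
have Yh : cY p (h ^+ 6) = - (6 * (h ^+ 7 * Yu)).
  rewrite /Yu /cY /gam !exprSr expr0 mul1r !sXM !Xh; ring.
have H1 := E_cY p (h ^+ 6) 1.
have Y1 : cY p 1 = 0 by rewrite /cY /gam !sX1 !mulr0 !addr0.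
rewrite Y1 mulr0 E0 !mulr1 Yh subr0 -/y in H1.
have yu : y * u * h ^+ 7 = y * h ^+ 6 by rewrite exprS mulrA -(mulrA y) uh mulr1.
have -> : (Yu + sfc (1 / 2) * (y * u)) * - (h ^+ 7 + sfc eps * u) =
   - (h ^+ 7 * Yu) - sfc (1 / 2) * (y * u * h ^+ 7) - sfc eps * (Yu * u)
   - sfc (1 / 2) * (sfc eps * (y * u * u)) by ring.
rewrite yu !(ED, EN, EZ) E_cY_self -/y.
have H6 : E (- (6 * (h ^+ 7 * Yu))) = - 6 * E (h ^+ 7 * Yu).
  have -> : - (6 * (h ^+ 7 * Yu)) = sfc (- 6) * (h ^+ 7 * Yu).
    by apply: SF_eq => x _; rewrite !sfE mulNr; congr (- (_ * _)).
  by rewrite EZ.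
rewrite H6 in H1 => H2.
have : eps * E (y * u * u) = 0 by lra.
by move=> /eqP; rewrite mulf_eq0 gt_eqF //= => /eqP.
Qed.

End MeanValue.

End Laplacian.

(** * The Green function *)

Section Bubble.
Variable R : realType.
Local Notation V := 'rV[R]_4.
Local Notation SF := (SF R).
Local Notation M := (qmx R).
Implicit Types (f g h u G H : SF) (x p q : V) (c d : R) (a b : 'I_3).

Definition dist p x : R := enorm (p - x).

Lemma dist_ge0 p x : 0 <= dist p x. Proof. exact: enorm_ge0. Qed.

Lemma distC p x : dist p x = dist x p. Proof. exact: enormB. Qed.

Lemma dist_sqr p x : S3 p -> S3 x -> dist p x ^+ 2 = 2 - 2 * sy p x.
Proof. by move=> Sp Sx; rewrite /dist sqr_enormB_S3 // syE. Qed.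

Lemma dist_le2 p x : S3 p -> S3 x -> dist p x <= 2.
Proof.
move=> Sp Sx; rewrite /dist; apply: le_trans (enormD _ _) _.
by rewrite enormN Sp Sx.
Qed.

Lemma dist_diff p x y : `|dist x y - dist x p| <= dist p y.
Proof. by rewrite [dist p y]distC; exact: enorm_dist. Qed.

(** The gradient of y at x is the tangential part of p, and Parseval in the frame gives its
    length. *)
Lemma gam_yy p : S3 p -> gam (sy p) (sy p) = 1 - sy p * sy p.
Proof.
move=> Sp; apply: SF_eq => x Sx.
rewrite /gam !sX_y !sfE !syE //.
have := dot_qmx_frame p x x; rewrite sum_ord3 (S3_dot Sp) (S3_dot Sx) mul1r !(dotC x).
by move=> H1; rewrite [X in X - _]H1; ring.
Qed.

Lemma sum3_sqr_ge (r s t : R) : [/\ r ^+ 2 <= r * r + s * s + t * t,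
  s ^+ 2 <= r * r + s * s + t * t & t ^+ 2 <= r * r + s * s + t * t].
Proof.
have := sqr_ge0 r; have := sqr_ge0 s; have := sqr_ge0 t; rewrite !expr2 => *.
by split; lra.
Qed.

Lemma gam_yy_le p a x : S3 p -> S3 x -> sX a (sy p) x ^+ 2 <= 1 - sy p x ^+ 2.
Proof.
move=> Sp Sx; have := congr1 (fun f : SF => f x) (gam_yy Sp).
rewrite /gam !sfE => E; rewrite [leRHS](_ : _ = sX 0 (sy p) x * sX 0 (sy p) x +
  sX 1 (sy p) x * sX 1 (sy p) x + sX 2 (sy p) x * sX 2 (sy p) x); last by rewrite E expr2.
have [H0 H1 H2] := sum3_sqr_ge (sX 0 (sy p) x) (sX 1 (sy p) x) (sX 2 (sy p) x).
by move: a; apply: ord3E.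
Qed.

(* G = sqrt (|x - p|^2 + d^2), smooth version of the chordal distance to p,
   and H = 1 / G. *)
Definition is_bubble p d G H : Prop := [/\ S3 p, 0 < d,
  G * G = sfc (2 + d ^+ 2) - 2 * sy p, forall x, S3 x -> 0 < G x & G * H = 1].

Lemma ex_bubble p d : S3 p -> 0 < d -> exists G H, is_bubble p d G H.
Proof.
move=> Sp d0.
have pos x : S3 x -> 0 < (sfc (2 + d ^+ 2) - 2 * sy p) x.
  move=> Sx; rewrite !sfE.
  have := sqr_ge0 (dist p x); rewrite dist_sqr //.
  have : 0 < d ^+ 2 by rewrite exprn_gt0.
  by lra.
have [G [GG Gp]] := ex_ssqrt pos.
have [H GH] : exists H : SF, G * H = 1 by apply: ex_sinv => x Sx; rewrite gt_eqF // Gp.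
by exists G, H; split.
Qed.

Section OneBubble.
Variables (p : V) (d : R) (G H : SF).
Hypothesis bub : is_bubble p d G H.

Lemma bubble_sqr x : S3 x -> G x ^+ 2 = dist p x ^+ 2 + d ^+ 2.
Proof.
case: bub => Sp _ GG _ _ Sx; rewrite dist_sqr // expr2 -sfM GG !sfE.
by ring.
Qed.

Lemma bubble_gt0 x : S3 x -> 0 < G x. Proof. by case: bub => _ _ _ + _; apply. Qed.

Lemma bubble_inv x : S3 x -> H x = (G x)^-1.
Proof.
case: bub => _ _ _ Gp GH Sx; have := congr1 (fun f : SF => f x) GH.
rewrite !sfE => E; apply: (mulfI (lt0r_neq0 (Gp _ Sx))).
by rewrite E mulfV // gt_eqF // Gp.
Qed.

Lemma bubble_ge x : S3 x -> dist p x <= G x.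
Proof.
move=> Sx; rewrite -(@ler_pXn2r _ 2) ?nnegrE ?dist_ge0 ?(ltW (bubble_gt0 _)) //.
by rewrite bubble_sqr // lerDl sqr_ge0.
Qed.

Lemma bubble_le x : S3 x -> G x <= dist p x + d.
Proof.
case: bub => _ d0 _ _ _ Sx; have D0 := dist_ge0 p x.
rewrite -(@ler_pXn2r _ 2) ?nnegrE ?addr_ge0 ?(ltW d0) ?(ltW (bubble_gt0 _)) //.
by rewrite bubble_sqr // sqrrD lerD2r lerDl mulrn_wge0 // mulr_ge0 // ltW.
Qed.

Lemma bubble_sX a x : S3 x -> sX a G x = - (sX a (sy p) x / G x).
Proof.
move=> Sx; case: (bub) => _ _ GG _ _.
have := congr1 (fun f => sX a f x) GG.
rewrite sXM sXD sXc sXN sX_mul2 add0r !sfE.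
have g0 := bubble_gt0 Sx => E.
apply: (mulIf (lt0r_neq0 g0)); rewrite mulNr divfK ?gt_eqF //.
by move: E; lra.
Qed.

(** The regularized distance stays 1-Lipschitz uniformly in d, since 1 - y^2 <= 2 - 2 y <= G^2. *)
Lemma bubble_sX_le a x : S3 x -> `|sX a G x| <= 1.
Proof.
move=> Sx; rewrite bubble_sX // normrN normrM normfV.
have g0 := bubble_gt0 Sx.
rewrite (gtr0_norm g0) ler_pdivrMr // mul1r.
rewrite -(@ler_pXn2r _ 2) ?nnegrE ?(ltW g0) // real_normK ?num_real //.
have Sp : S3 p by case: bub.
apply: le_trans (gam_yy_le a Sp Sx) _.
rewrite bubble_sqr // dist_sqr //.
have := sqr_ge0 d; have := sqr_ge0 (1 - sy p x); rewrite !expr2; lra.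
Qed.

Let A := 2 + d ^+ 2.

(** With y eliminated, the Laplacians of powers of G become Laurent polynomials in G, and
    [pan_bubble] reduces to a rational identity in one variable. *)
Lemma sy_bubble : sy p = sfc (1 / 2) * (sfc A - G * G).
Proof.
case: bub => _ _ -> _ _; apply: SF_eq => x _; rewrite !sfE.
by rewrite /A; field.
Qed.

Lemma sX_bubble a : sX a G = - (H * sX a (sy p)).
Proof.
apply: SF_eq => x Sx; rewrite bubble_sX // !sfE bubble_inv //.
by congr (- _); rewrite mulrC.
Qed.

Lemma sX_bubble_inv a : sX a H = - (H * H * sX a G).
Proof. by apply: sX_inv; case: bub. Qed.

Lemma gam_bubble : gam G G = H * H * (1 - sy p * sy p).
Proof.
rewrite -gam_yy; last by case: bub.
by rewrite /gam !sX_bubble; ring.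
Qed.

Lemma lap_bubble0 : lap G = 3 * sy p * H - H * H * H * (1 - sy p * sy p).
Proof.
rewrite -gam_yy; last by case: bub.
have L := lap_y p.
have -> : 3 * sy p = - lap (sy p) by rewrite L opprK.
by rewrite /lap /gam !sX_bubble !sXN !sXM !sX_bubble_inv !sX_bubble; ring.
Qed.

Lemma lap_bubble : lap G = sfc A * H - sfc (5 / 4) * G + sfc (A ^+ 2 / 4 - 1) * (H * H * H).
Proof.
rewrite lap_bubble0 sy_bubble; apply: SF_eq => x Sx; rewrite !sfE bubble_inv //.
by field; rewrite gt_eqF // bubble_gt0.
Qed.

Lemma lap_bubble_inv : lap H = 2 * (H * H * H * gam G G) - H * H * lap G.
Proof. by rewrite /lap /gam !sX_bubble_inv !sXN !sXM !sX_bubble_inv; ring. Qed.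

Lemma gam_bubble_inv : gam H H = H * H * H * H * gam G G.
Proof. by rewrite /gam !sX_bubble_inv; ring. Qed.

Lemma lap_bubble_inv3 : lap (H * H * H) = 3 * (H * H * lap H) + 6 * (H * gam H H).
Proof.
have gH : gam (H * H) H = 2 * (H * gam H H) by rewrite /gam !sXM; ring.
by rewrite !lapM gH; ring.
Qed.

(** Equal to d^4 (4 + d^2)^2, so it tends to 0 with d; times H^7 it is the concentrating kernel. *)
Definition bubble_const := ((2 + d ^+ 2) ^+ 2 - 4) ^+ 2.

Lemma pan_bubble : pan G = sfc (- (15 / 16 * bubble_const)) * H ^+ 7.
Proof.
have gG : gam G G = H * H * (1 - sy p * sy p) := gam_bubble.
rewrite /pan lap_bubble !lapD lapN !lapZ lap_bubble_inv3 gam_bubble_inv lap_bubble_inv.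
rewrite lap_bubble gG sy_bubble.
apply: SF_eq => x Sx; rewrite !sfE bubble_inv //.
rewrite /bubble_const -/A.
by field; rewrite gt_eqF // bubble_gt0.
Qed.

End OneBubble.

End Bubble.

(** * Concentration of the bubbles *)

Section Representation.
Variable R : realType.
Local Notation V := 'rV[R]_4.
Local Notation SF := (SF R).
Implicit Types (f g h u G H : SF) (x p q : V) (c d e : R) (a b : 'I_3) (F K : V -> R).
Variable A : (V -> R) -> R.
Hypothesis hA : is_mean A.

Lemma bS_cst c : bS (fun _ : V => c). Proof. by exists `|c|. Qed.

Lemma bS_dist p : S3 p -> bS (dist p).
Proof. by move=> Sp; exists 2 => x Sx; rewrite ger0_norm ?dist_ge0 ?dist_le2. Qed.

Lemma bS_add F K : bS F -> bS K -> bS (fun x => F x + K x).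
Proof.
move=> [B FB] [C KC]; exists (B + C) => x Sx; apply: le_trans (ler_normD _ _) _.
by rewrite lerD ?FB ?KC.
Qed.

Lemma bS_mul F K : bS F -> bS K -> bS (fun x => F x * K x).
Proof.
move=> [B FB] [C KC]; exists (B * C) => x Sx; rewrite normrM.
by rewrite ler_pM ?FB ?KC.
Qed.

Lemma bS_opp F : bS F -> bS (fun x => - F x).
Proof. by move=> [B FB]; exists B => x Sx; rewrite normrN FB. Qed.

Lemma A_le F K : bS F -> bS K -> (forall x, S3 x -> F x <= K x) -> A F <= A K.
Proof. by case: hA => _ _ L _; exact: L. Qed.

Lemma A_lin c F K : bS F -> bS K -> A (fun x => c * F x + K x) = c * A F + A K.
Proof. by case: hA => _ L _ _; exact: L. Qed.

Lemma A_add F K : bS F -> bS K -> A (fun x => F x + K x) = A F + A K.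
Proof.
move=> bF bK; rewrite -[A F]mul1r -A_lin //.
by congr A; apply/funext => x; rewrite mul1r.
Qed.

Lemma A_scale c F : bS F -> A (fun x => c * F x) = c * A F.
Proof.
move=> bF; have H0 := A_lin 1 (bS_cst 0) (bS_cst 0).
have A0 : A (fun=> 0) = 0.
  have E0 : (fun _ : V => 1 * 0 + 0 : R) = (fun=> 0) by apply/funext => x; ring.
  by move: H0; rewrite E0; lra.
rewrite -[RHS]addr0 -A0 -A_lin //; last exact: bS_cst.
by congr A; apply/funext => x; rewrite addr0.
Qed.

Lemma A_cst c : A (fun=> c) = c.
Proof.
have A1 : A (cst 1) = 1 by case: hA.
rewrite -[RHS]mulr1 -A1 -(A_scale c (bS_cst 1)).
by congr A; apply/funext => x; rewrite mulr1.
Qed.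

Lemma A_sub F K : bS F -> bS K -> A (fun x => F x - K x) = A F - A K.
Proof.
move=> bF bK; rewrite (A_add bF (bS_opp bK)); congr (_ + _).
by rewrite -mulN1r -A_scale //; congr A; apply/funext => x; rewrite mulN1r.
Qed.

Lemma A_norm_le F K : bS F -> bS K -> (forall x, S3 x -> `|F x| <= K x) -> `|A F| <= A K.
Proof.
move=> bF bK FK; rewrite ler_norml; apply/andP; split.
  rewrite -mulN1r -A_scale //; apply: A_le => //.
    by apply: bS_mul => //; exact: bS_cst.
  by move=> x /FK; rewrite ler_norml mulN1r => /andP[].
by apply: A_le => // x /FK; rewrite ler_norml => /andP[].
Qed.

Lemma A_norm_le_cst F B : (forall x, S3 x -> `|F x| <= B) -> `|A F| <= B.
Proof.
move=> FB; rewrite -[leRHS]A_cst; apply: A_norm_le => //; first by exists B.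
exact: bS_cst.
Qed.

Definition kap p : R := A (dist p).

Lemma E_sy p : SFmean A (sy p) = 0.
Proof.
have := E_lap hA (sy p); rewrite lap_y EN // EM3 // => /eqP.
by rewrite oppr_eq0 mulf_eq0 pnatr_eq0 /= => /eqP.
Qed.

(** As |x - p| <= 2, the distance is at least |x - p|^2 / 2 = 1 - y, and y has mean 0. *)
Lemma kap_ge1 p : S3 p -> 1 <= kap p.
Proof.
move=> Sp; have E1' : SFmean A (1 - sy p) = 1 by rewrite ED // EN // E1 // E_sy subr0.
rewrite -E1'; apply: A_le; [exact: bS_SF|exact: bS_dist|] => x Sx.
rewrite !sfE; have := dist_sqr Sp Sx; have := dist_ge0 p x; have := dist_le2 Sp Sx.
set t := dist p x; set y := sy p x; nra.
Qed.

Lemma kap_le2 p : S3 p -> kap p <= 2.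
Proof.
move=> Sp; rewrite -[leRHS]A_cst; apply: A_le; [exact: bS_dist|exact: bS_cst|].
by move=> x Sx; exact: dist_le2.
Qed.

(* A modulus of continuity at p in the form suited to testing against the
   concentrating kernels H^7. *)
Definition osc F p := forall e, 0 < e -> exists C, forall x, S3 x ->
  `|F x - F p| <= e + C * dist p x ^+ 7.

Lemma osc_dist p q : S3 p -> S3 q -> osc (dist q) p.
Proof.
move=> Sp Sq e e0; exists (e ^- 6) => x Sx.
apply: le_trans (dist_diff p q x) _.
have D0 := dist_ge0 p x; have [De|eD] := leP (dist p x) e.
  (* Beyond distance e, the distance D satisfies D <= e^-6 D^7, hence the constant e^-6. *)
  by rewrite ler_wpDr // mulr_ge0 ?invr_ge0 ?exprn_ge0 // ltW.
apply: ler_wpDl; first exact: ltW.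
rewrite (exprS (dist p x)) mulrCA -[leLHS]mulr1 ler_wpM2l // -exprVn -exprMn exprn_ege1 //.
by rewrite mulrC ler_pdivlMr // mul1r ltW.
Qed.

Lemma osc_SF f p : S3 p -> osc f p.
Proof.
move=> Sp e e0; have p0 := S3_neq0 Sp.
have cf := differentiable_continuous (SF_diff f p0).
have /nbhs_normP [r /= r0 P] : \forall y \near p, `|f p - f y| < e.
  by move/cvgrPdist_lt : cf; exact.
have [B fB] := S3_bounded f.
have B0 : 0 <= B by apply: le_trans (fB p Sp).
exists (2 * B * r ^- 7) => x Sx.
have D0 := dist_ge0 p x; have [De|eD] := ltP (dist p x) r.
  rewrite distrC; apply: le_trans (ltW (P x _)) _.
    apply: le_lt_trans De.
    have -> : `|p - x| = mx_norm (p - x) by [].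
    rewrite mx_normrE; apply/bigmax_leP; split => // -[i j] _ /=.
    have := normr_dot_le (p - x) (std_basis R j).
    by rewrite dot_std_basis S3_std_basis mulr1 ord1.
  by rewrite ler_wpDr // mulr_ge0 ?exprn_ge0 // mulr_ge0 ?mulr_ge0 // invr_ge0 exprn_ge0 // ltW.
apply: ler_wpDl; first exact: ltW.
apply: le_trans (ler_normB _ _) _; apply: le_trans (_ : 2 * B <= _).
  by have := fB x Sx; have := fB p Sp; lra.
rewrite -(mulrA (2 * B)); apply: ler_peMr; first by rewrite mulr_ge0.
rewrite -exprVn -exprMn exprn_ege1 //.
by rewrite mulrC ler_pdivlMr // mul1r.
Qed.

Lemma bubble_const_ge0 d : 0 <= bubble_const d. Proof. exact: sqr_ge0. Qed.

Lemma bubble_const_le d : 0 < d <= 1 -> bubble_const d <= 25 * d.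
Proof.
move=> /andP[d0 d1]; rewrite /bubble_const.
have -> : (2 + d ^+ 2) ^+ 2 - 4 = d * (d * (4 + d ^+ 2)) by ring.
have h0 : 0 <= d * (4 + d ^+ 2) by rewrite mulr_ge0 ?addr_ge0 ?sqr_ge0 // ltW.
have h5 : d * (4 + d ^+ 2) <= 5 by nra.
set k := d * _ in h0 h5 *; rewrite exprMn.
have k2 : k ^+ 2 <= 25 by nra.
have : 0 <= k ^+ 2 by exact: sqr_ge0.
by set m := k ^+ 2 in k2 *; nra.
Qed.

Section OneBubble.
Variables (p : V) (d : R) (G H : SF).
Hypothesis bub : is_bubble p d G H.

(** Both sides come from the mean of P G: P is symmetric and acts on constants by -15/16. *)
Lemma bubble_mass : bubble_const d * SFmean A (H ^+ 7) = SFmean A G.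
Proof.
have := E_pan hA G; rewrite (pan_bubble bub) EZ //.
by set l := bubble_const d; set s := SFmean A _; set t := SFmean A _; lra.
Qed.

Lemma bubble_pair_pan f :
  SFmean A (G * pan f) = - (15 / 16) * bubble_const d * SFmean A (f * H ^+ 7).
Proof.
rewrite -E_pan_sym // (pan_bubble bub) -mulrA EZ // (mulrC (H ^+ 7)).
by rewrite !mulNr.
Qed.

Lemma bubble_near F B : bS F -> (forall x, S3 x -> `|F x| <= B) ->
  `|A (fun x => G x * F x) - A (fun x => dist p x * F x)| <= d * B.
Proof.
move=> bF FB; have Sp : S3 p by case: bub.
have bD := bS_dist Sp; have bG := bS_SF G.
rewrite -A_sub; [|exact: bS_mul|exact: bS_mul].
apply: A_norm_le_cst => x Sx; rewrite -mulrBl normrM; apply: ler_pM => //; last exact: FB.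
have h1 := bubble_ge bub Sx; have h2 := bubble_le bub Sx.
by rewrite ger0_norm ?subr_ge0 // lerBlDl.
Qed.

Lemma bubble_E_near : `|SFmean A G - kap p| <= d.
Proof.
have := @bubble_near (fun=> 1) 1 (bS_cst 1).
have N1 (x : V) : S3 x -> `|1 : R| <= 1 by rewrite normr1.
move=> /(_ N1); rewrite mulr1.
have -> : (fun x => G x * 1) = G :> (V -> R) by apply/funext => x; exact: mulr1.
by have -> : (fun x => dist p x * 1) = dist p :> (V -> R) by apply/funext => x; exact: mulr1.
Qed.

(** The part e of the oscillation is multiplied by the total mass, at most kap + d <= 3. In the
    other part H absorbs the distance, as |x - p| H <= 1, and only [bubble_const d] <= 25 d
    remains. *)
Lemma bubble_conc F e C : bS F -> 0 < e -> 0 <= C -> 0 < d <= 1 ->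
  (forall x, S3 x -> `|F x - F p| <= e + C * dist p x ^+ 7) ->
  `|bubble_const d * A (fun x => F x * H x ^+ 7) - F p * SFmean A G| <= 3 * e + C * (25 * d).
Proof.
move=> bF e0 C0 d01 FC; have Sp : S3 p by case: bub.
have d0 : 0 < d by case: bub.
have bH : bS (fun x => H x ^+ 7).
  by have [B HB] := S3_bounded (H ^+ 7); exists B => x /HB; rewrite sfX.
have EH : A (fun x => H x ^+ 7) = SFmean A (H ^+ 7).
  by rewrite /SFmean; congr A; apply/funext => x; rewrite sfX.
have l0 := bubble_const_ge0 d.
rewrite -bubble_mass mulrCA -EH -mulrBr -[F p * _]A_scale // -A_sub; last 2 first.
- exact: bS_mul.
- by apply: bS_mul => //; exact: bS_cst.
rewrite normrM ger0_norm //.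
have bK : bS (fun x => e * H x ^+ 7 + C) by apply: bS_add; [apply: bS_mul => //|]; exact: bS_cst.
apply: le_trans (_ : bubble_const d * A (fun x => e * H x ^+ 7 + C) <= _).
  rewrite ler_wpM2l //; apply: A_norm_le => //.
    apply: bS_add; first exact: bS_mul.
    by apply: bS_opp; apply: bS_mul => //; exact: bS_cst.
  move=> x Sx; rewrite -mulrBl normrM.
  have g0 := bubble_gt0 bub Sx.
  have h7 : 0 <= H x ^+ 7 by rewrite exprn_ge0 // (bubble_inv bub Sx) invr_ge0 ltW.
  rewrite (ger0_norm h7); apply: le_trans (ler_wpM2r h7 (FC x Sx)) _.
  rewrite mulrDl lerD2l -mulrA -exprMn -[leRHS]mulr1 ler_wpM2l // exprn_ile1 //.
    by rewrite mulr_ge0 ?dist_ge0 // (bubble_inv bub Sx) invr_ge0 ltW.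
  by rewrite (bubble_inv bub Sx) ler_pdivrMr // mul1r (bubble_ge bub Sx).
rewrite A_lin //; last exact: bS_cst.
rewrite A_cst mulrDr EH mulrCA bubble_mass; apply: lerD.
  rewrite mulrC ler_wpM2r ?(ltW e0) //.
  have := bubble_E_near; have := kap_le2 Sp; rewrite ler_norml => h1 /andP[_ h2].
  by have /andP[_ d1] := d01; lra.
by rewrite mulrC ler_wpM2l // bubble_const_le.
Qed.

End OneBubble.

Lemma eq_of_small (r s : R) : (forall e, 0 < e -> exists C, forall d, 0 < d <= 1 ->
  `|r - s| <= e + C * d) -> r = s.
Proof.
move=> Hs; apply/eqP; rewrite -subr_eq0 -normr_eq0 eq_le normr_ge0 andbT.
apply/ler_addgt0Pl => e e0; rewrite addr0.
have e2 : 0 < e / 2 by rewrite divr_gt0.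
have [K HK] := Hs _ e2.
have K0 : 0 < `|K| + 1 by rewrite ltr_wpDl.
pose d := Num.min 1 (e / 2 / (`|K| + 1)).
have d0 : 0 < d by rewrite lt_min ltr01 divr_gt0.
have d1 : d <= 1 by rewrite ge_min lexx.
have dK : d * (`|K| + 1) <= e / 2 by rewrite -ler_pdivlMr // ge_min lexx orbT.
have := HK d; rewrite d0 d1 => /(_ isT) Hd.
apply: le_trans Hd _.
have : K * d <= (`|K| + 1) * d.
  by rewrite ler_pM2r //; apply: le_trans (ler_norm _) _; rewrite lerDl.
lra.
Qed.

End Representation.

(** * A priori estimates *)

Section Estimates.
Variable R : realType.
Local Notation V := 'rV[R]_4.
Local Notation SF := (SF R).
Implicit Types (f g h u G H : SF) (x p q : V) (c d e B : R) (a b : 'I_3) (F K : V -> R).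
Variable A : (V -> R) -> R.
Hypothesis hA : is_mean A.

Local Notation kap := (kap A).
Local Notation E := (SFmean A).

Lemma rep_arith (k fp eg b s t e d C Bf Bp : R) : 0 <= Bf ->
  `|b - fp * eg| <= 3 * e + C * (25 * d) -> `|eg - k| <= d -> `|fp| <= Bf ->
  `|s - t| <= d * Bp -> s = - (15 / 16) * b ->
  `|15 / 16 * k * fp - - t| <= 3 * e + (25 * C + Bf + Bp) * d.
Proof.
move=> Bf0 H1 H2 H3 H4 H5.
have {H2 H3} H6 : `|fp * (eg - k)| <= Bf * d by rewrite normrM ler_pM.
move: H1 H4 H6; rewrite !ler_norml => /andP[a1 a2] /andP[a3 a4] /andP[a5 a6].
by apply/andP; split; lra.
Qed.

(** The limit of [bubble_pair_pan] as d tends to 0: G tends uniformly to the distance and the kernel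
    tends to kap times evaluation at p. *)
Lemma representation f p : S3 p ->
  15 / 16 * kap p * f p = - A (fun x => dist p x * pan f x).
Proof.
move=> Sp; apply: eq_of_small => e e0.
have e3 : 0 < e / 3 by rewrite divr_gt0.
have [C HC] := osc_SF f Sp e3.
have [Bf HBf] := S3_bounded f; have [Bp HBp] := S3_bounded (pan f).
exists (25 * `|C| + Bf + Bp) => d d01.
have d0 : 0 < d by case/andP: d01.
have [G [H bub]] := ex_bubble Sp d0.
have HC' x : S3 x -> `|f x - f p| <= e / 3 + `|C| * dist p x ^+ 7.
  move=> Sx; apply: le_trans (HC x Sx) _; rewrite lerD2l ler_wpM2r ?ler_norm //.
  by rewrite exprn_ge0 // dist_ge0.
have H1 := bubble_conc hA bub (bS_SF f) e3 (normr_ge0 C) d01 HC'.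
have H2 := bubble_E_near hA bub.
have H4 := bubble_near hA bub (bS_SF (pan f)) HBp.
have H5 := bubble_pair_pan hA bub f.
have Bf0 : 0 <= Bf by exact: le_trans (HBf p Sp).
have -> : e = 3 * (e / 3) by rewrite mulrC divfK // pnatr_eq0.
apply: (rep_arith Bf0 H1 H2 (HBf p Sp) H4).
rewrite mulrA; move: H5; rewrite /SFmean.
have -> : sf (f * H ^+ 7) = (fun x => f x * H x ^+ 7).
  by apply/funext => x; rewrite sfM sfX.
by [].
Qed.

Lemma kap_arith (kp kq gp D eg b e d C : R) : 0 <= D <= 2 -> 0 <= d -> `|kp| <= 2 ->
  kp * gp = b -> `|b - D * eg| <= 3 * e + C * (25 * d) -> `|eg - kq| <= d ->
  `|gp - D| <= d -> `|kp * D - D * kq| <= 3 * e + (25 * C + 4) * d.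
Proof.
move=> /andP[D0 D2] d0 kp2 Eb H1 H2 H3.
have H4 : `|kp * (gp - D)| <= 2 * d by rewrite normrM ler_pM.
have H5 : `|D * (eg - kq)| <= 2 * d by rewrite normrM ler_pM // ger0_norm.
move: H1 H4 H5; rewrite -Eb !ler_norml => /andP[a1 a2] /andP[a3 a4] /andP[a5 a6].
by apply/andP; split; lra.
Qed.

(** Symmetry of the Green function stands in for rotation invariance of the mean. Representing at p
    the bubble centred at q and letting d tend to 0 gives kap p |p - q| = kap q |p - q|. *)
Lemma kap_const p q : S3 p -> S3 q -> kap p = kap q.
Proof.
move=> Sp Sq; have [->//|pq] := eqVneq p q.
have D0 : 0 < dist p q by rewrite enorm_gt0 // subr_eq0.
apply: (mulIf (lt0r_neq0 D0)); rewrite [RHS]mulrC; apply: eq_of_small => e e0.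
have e3 : 0 < e / 3 by rewrite divr_gt0.
have [C HC] := osc_dist Sq Sp e3.
exists (25 * `|C| + 4) => d d01.
have d0 : 0 < d by case/andP: d01.
have [G [H bub]] := ex_bubble Sq d0.
have HC' x : S3 x -> `|dist p x - dist p q| <= e / 3 + `|C| * dist q x ^+ 7.
  move=> Sx; apply: le_trans (HC x Sx) _; rewrite lerD2l ler_wpM2r ?ler_norm //.
  by rewrite exprn_ge0 // dist_ge0.
have H1 := bubble_conc hA bub (bS_dist Sp) e3 (normr_ge0 C) d01 HC'.
have H2 := bubble_E_near hA bub.
have -> : e = 3 * (e / 3) by rewrite mulrC divfK // pnatr_eq0.
have H3 : `|G p - dist p q| <= d.
  have h1 := bubble_ge bub Sp; have h2 := bubble_le bub Sp.
  by rewrite distC ger0_norm ?subr_ge0 // lerBlDl.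
apply: (kap_arith (gp := G p) _ (ltW d0) _ _ H1 H2 H3).
- by rewrite ltW //= dist_le2.
- by rewrite ger0_norm ?kap_le2 //; apply: le_trans (kap_ge1 hA Sp).
have := representation G Sp.
have bH : bS (fun x => dist p x * H x ^+ 7).
  apply: bS_mul; first exact: bS_dist.
  by have [B HB] := S3_bounded (H ^+ 7); exists B => x /HB; rewrite sfX.
have -> : (fun x => dist p x * pan G x) =
  (fun x => - (15 / 16 * bubble_const d) * (dist p x * H x ^+ 7)).
  by apply/funext => x; rewrite (pan_bubble bub) !sfE mulrCA.
by rewrite A_scale //; set b := bubble_const d; set t := A _; set k := kap p; set g := G p; lra.
Qed.

(** Represent X_a f, commute X_a with P and integrate by parts onto the kernel. This requires the
    smooth bubble in place of the distance. *)
Lemma grad_bound f B a p : S3 p -> (forall x, S3 x -> `|pan f x| <= B) ->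
  `|sX a f p| <= 16 / 15 * B.
Proof.
move=> Sp fB; apply/ler_addgt0Pl => e e0.
have [B' HB'] := S3_bounded (pan (sX a f)).
have B0 : 0 < `|B'| + 1 by rewrite ltr_wpDl.
(* The bound [B'] on the higher derivative of f is uncontrolled, but it only governs the choice of d
   and disappears with e. *)
pose d := e / 2 / (`|B'| + 1).
have d0 : 0 < d by rewrite !divr_gt0.
have [G [H bub]] := ex_bubble Sp d0.
have H1 := bubble_near hA bub (bS_SF (pan (sX a f))) HB'.
have H2 : `|E (G * pan (sX a f))| <= B.
  rewrite sX_pan mulrC EX_parts // normrN; apply: A_norm_le_cst => // x Sx.
  rewrite sfM normrM -[leRHS]mulr1; apply: ler_pM => //; first exact: fB.
  exact: (bubble_sX_le bub).
have H3 := representation (sX a f) Sp.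
have k1 := kap_ge1 hA Sp.
have H4 : 15 / 16 * kap p * `|sX a f p| <= B + d * B'.
  have k0 : 0 <= 15 / 16 * kap p by rewrite mulr_ge0 // (le_trans _ k1).
  rewrite -{1}(ger0_norm k0) -normrM H3 normrN.
  have -> : A (fun x => dist p x * pan (sX a f) x) = E (G * pan (sX a f)) -
    (A (fun x => G x * pan (sX a f) x) - A (fun x => dist p x * pan (sX a f) x)).
    by rewrite opprB addrCA subrr addr0.
  by apply: le_trans (ler_normB _ _) _; apply: lerD.
have H5 : d * B' <= e / 2.
  apply: le_trans (_ : d * (`|B'| + 1) <= _); last by rewrite divfK // gt_eqF.
  by rewrite ler_pM2l //; apply: le_trans (ler_norm _) _; rewrite lerDl.
have H6 : 15 / 16 * `|sX a f p| <= 15 / 16 * kap p * `|sX a f p|.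
  by rewrite ler_wpM2r // ler_peMr.
by lra.
Qed.

(** The Laplacian of y^2 is 2 - 8 y^2 and has mean 0. *)
Lemma E_sy_sqr p : S3 p -> E (sy p * sy p) = 1 / 4.
Proof.
move=> Sp; have := E_lap hA (sy p * sy p); rewrite lapM lap_y gam_yy //.
have -> : - (3 * sy p) * sy p + sy p * - (3 * sy p) + 2 * (1 - sy p * sy p) =
  sfc 2 - sfc 8 * (sy p * sy p).
  by apply: SF_eq => x _; rewrite !sfE; ring.
have -> : sfc 2 = sfc 2 * 1 :> SF by rewrite mulr1.
by rewrite ED // EN // !EZ // E1 //; lra.
Qed.

(** * Two-sided bounds for solutions *)

Section Solution.
Variables (eps : R) (u h : SF).
Hypotheses (eps0 : 0 < eps) (eps1 : eps < 1 / 2).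
Hypotheses (u0 : forall x, S3 x -> 0 < u x) (uh : u * h = 1).
Hypothesis eqn : pan u = - (h ^+ 7 + sfc eps * u).

Let F : SF := h ^+ 7 + sfc eps * u.
Let m : R := E F.

Lemma h_inv x : S3 x -> h x = (u x)^-1.
Proof.
move=> Sx; have := congr1 (fun f : SF => f x) uh; rewrite !sfE => E1.
by apply: (mulfI (lt0r_neq0 (u0 Sx))); rewrite E1 mulfV // gt_eqF // u0.
Qed.

Let F_ge0 x : S3 x -> 0 <= F x.
Proof.
move=> Sx; rewrite !sfE addr_ge0 ?exprn_ge0 ?mulr_ge0 ?(ltW eps0) ?(ltW (u0 Sx)) //.
by rewrite h_inv // invr_ge0 ltW // u0.
Qed.

Let m_ge0 : 0 <= m.
Proof. by rewrite /m -(E0 hA); apply: E_le => // x Sx; exact: F_ge0. Qed.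

Lemma sol_rep p : S3 p -> 15 / 16 * kap p * u p = A (fun x => dist p x * F x).
Proof.
move=> Sp; rewrite representation // eqn.
have bF : bS (fun x => dist p x * F x) by apply: bS_mul; [exact: bS_dist|exact: bS_SF].
rewrite -mulN1r -A_scale //.
  by congr A; apply/funext => x; rewrite sfN mulrN mulN1r opprK.
have [B HB] := bF; exists B => x Sx; apply: le_trans (HB x Sx).
by rewrite sfN mulrN normrN.
Qed.

(* As u is a potential of F, a small value of u at p forces F to concentrate
   at p. *)
Lemma sol_conc p x : S3 p -> S3 x ->
  `|15 / 16 * kap x * u x - m * dist x p| <= 15 / 16 * kap p * u p.
Proof.
move=> Sp Sx; rewrite !sol_rep //.
have bD q : S3 q -> bS (fun z => dist q z * F z).
  by move=> Sq; apply: bS_mul; [exact: bS_dist|exact: bS_SF].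
have bF := bS_SF F.
rewrite /m [_ * dist x p]mulrC -A_scale // -A_sub //; last 2 first.
- exact: bD.
- by apply: bS_mul => //; exact: bS_cst.
apply: A_norm_le => //; [|exact: bD|].
  apply: bS_add; first exact: bD.
  by apply: bS_opp; apply: bS_mul => //; exact: bS_cst.
move=> z Sz; rewrite -mulrBl normrM (ger0_norm (F_ge0 Sz)) ler_wpM2r ?F_ge0 //.
exact: dist_diff.
Qed.

(** Expand w = n D + r with |r| <= k. The square of n D gives the main term through D^2 = 2 - 2 y,
    and |y| <= 1, D <= 2 control the rest. *)
Lemma sol_pointwise (y D w n k : R) : 0 <= n -> -1 <= y <= 1 -> 0 <= D <= 2 ->
  D ^+ 2 = 2 - 2 * y -> `|w - n * D| <= k ->
  y * w ^+ 2 <= n ^+ 2 * (2 * y - 2 * y ^+ 2) + (4 * n * k + k ^+ 2).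
Proof.
move=> n0 /andP[y0 y1] /andP[D0 D2] HD Hw.
pose r := w - n * D; have -> : w = n * D + r by rewrite /r; ring.
have k0 : 0 <= k by exact: le_trans (normr_ge0 _) Hw.
have -> : y * (n * D + r) ^+ 2 = n ^+ 2 * (y * D ^+ 2) + y * (2 * (n * D) * r + r ^+ 2) by ring.
rewrite HD; apply: lerD; first by rewrite le_eqVlt; apply/orP; left; apply/eqP; ring.
apply: le_trans (ler_norm _) _; rewrite normrM.
apply: le_trans (_ : 1 * `|2 * (n * D) * r + r ^+ 2| <= _).
  by rewrite ler_wpM2r // ler_norml y0.
rewrite mul1r; apply: le_trans (ler_normD _ _) _; apply: lerD.
  rewrite normrM ger0_norm ?mulr_ge0 //; apply: ler_pM => //; first by rewrite !mulr_ge0.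
  by nra.
by rewrite normrX lerXn2r ?nnegrE.
Qed.

(* If u were small at p then (kap * u)^2 would be close to
   m^2 |x - p|^2 = 2 m^2 (1 - y), contradicting the balance E (y u^2) = 0. *)
Lemma sol_lower p : S3 p -> m <= 10 * (15 / 16 * kap p * u p).
Proof.
move=> Sp; set k := 15 / 16 * kap p * u p.
have K := kazdan_warner hA p eps0 uh eqn.
pose c : R := 15 / 16 * kap p.
have k0 : 0 <= k by apply: le_trans (normr_ge0 _) (sol_conc Sp Sp).
have H1 : E (sfc (c ^+ 2) * (sy p * u * u)) <=
   E (sfc (m ^+ 2) * (sfc 2 * sy p - sfc 2 * (sy p * sy p)) + sfc (4 * m * k + k ^+ 2) * 1).
  apply: E_le => // x Sx.
  have y1 : -1 <= sy p x <= 1.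
    by rewrite (syE p Sx) -ler_norml; have := normr_dot_le p x; rewrite Sp Sx mulr1.
  have := @sol_pointwise (sy p x) (dist p x) (c * u x) m k m_ge0.
  rewrite !sfE mulr1 => H2.
  have -> : c ^+ 2 * (sy p x * u x * u x) = sy p x * (c * u x) ^+ 2 by ring.
  rewrite -expr2; apply: H2 => //; first by rewrite dist_ge0 dist_le2.
    by rewrite dist_sqr.
  by have := sol_conc Sp Sx; rewrite /c (kap_const Sx Sp) (distC p).
(* The means leave m^2 / 2 <= 4 m k + k^2, whereas k < m / 10 would make the right side smaller than
   0.41 m^2. This is the origin of the factor 10. *)
move: H1; rewrite EZ // K mulr0 ED // !EZ // ED // EN // !EZ // E_sy // E_sy_sqr // E1 //.
rewrite mulr0 mulr1 => H1; rewrite leNgt; apply/negP => km.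
have : k * k <= m / 10 * k by rewrite ler_wpM2r //; lra.
have : m * k <= m * (m / 10) by rewrite ler_wpM2l //; lra.
have m0 : 0 < m by apply: le_lt_trans km; rewrite mulr_ge0.
have : m / 10 * k <= m / 10 * (m / 10) by rewrite ler_wpM2l ?divr_ge0 //; lra.
have : 0 < m * m by rewrite mulr_gt0.
by move: H1; rewrite !expr2; lra.
Qed.

Lemma sol_upper p : S3 p -> 15 / 16 * kap p * u p <= 2 * m.
Proof.
move=> Sp; rewrite sol_rep // /m -A_scale; [|exact: hA|exact: bS_SF].
apply: A_le => //.
- by apply: bS_mul; [exact: bS_dist|exact: bS_SF].
- by apply: bS_mul; [exact: bS_cst|exact: bS_SF].
by move=> x Sx; rewrite ler_wpM2r ?F_ge0 // dist_le2.
Qed.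

Lemma sol_balance : (15 / 16 - eps) * E u = E (h ^+ 7).
Proof.
have := E_pan hA u; rewrite eqn EN // ED // EZ //.
by set s := E _; set t := E _; lra.
Qed.

Lemma pow8_le (s : R) : 0 < s -> 7 / 16 * s <= s ^- 7 -> s <= 2.
Proof.
move=> s0 H1; have s7 : 0 < s ^+ 7 by rewrite exprn_gt0.
have {}H1 : 7 / 16 * s * s ^+ 7 <= 1 by rewrite -ler_pdivlMr // div1r.
rewrite leNgt; apply/negP => s2.
have : 2 ^+ 8 < s ^+ 8 by rewrite ltrXn2r // nnegrE ltW.
have -> : 2 ^+ 8 = 256 :> R by ring.
by rewrite exprS; lra.
Qed.

Lemma pow8_ge (s : R) : 0 < s -> s ^- 7 <= s -> 1 <= s.
Proof.
move=> s0 H1; have s7 : 0 < s ^+ 7 by rewrite exprn_gt0.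
have {}H1 : 1 <= s * s ^+ 7 by rewrite -ler_pdivrMr // div1r.
rewrite leNgt; apply/negP => s1.
have : s ^+ 8 < 1 by rewrite exprn_ilt1 // ltW.
by rewrite exprS; lra.
Qed.

(** By [sol_lower] and [sol_upper], u lies between s and t = 20 s. Since 7/16 <= 15/16 - eps <= 1,
    the balance law forces 7/16 s <= s^-7 and t^-7 <= t, so s <= 2 and t >= 1. *)
Lemma sol_bounds p : S3 p -> 1 / 20 <= u p /\ u p <= 40.
Proof.
have e1 : 7 / 16 <= 15 / 16 - eps by move: eps1; lra.
have e2 : 15 / 16 - eps <= 1 by move: eps0; lra.
move=> Sp; pose k := 15 / 16 * kap p.
have k0 : 0 < k by have := kap_ge1 hA Sp; rewrite /k; lra.
have k10 : 0 < 10 * k by lra.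
have lo x : S3 x -> m / (10 * k) <= u x.
  move=> Sx; rewrite ler_pdivrMr //.
  by have := sol_lower Sx; rewrite (kap_const Sx Sp) -/k; lra.
have hi x : S3 x -> u x <= 2 * m / k.
  move=> Sx; rewrite ler_pdivlMr // mulrC.
  by have := sol_upper Sx; rewrite (kap_const Sx Sp) -/k; lra.
have m0 : 0 < m.
  have := lt_le_trans (u0 Sp) (hi p Sp).
  by rewrite ltr_pdivlMr // mul0r pmulr_rgt0.
set s := m / (10 * k) in lo *; set t := 2 * m / k in hi *.
have ts : t = 20 * s by rewrite /s /t; field; rewrite gt_eqF.
have s0 : 0 < s by rewrite divr_gt0.
have t0 : 0 < t by rewrite ts mulr_gt0.
have EB := sol_balance.
have E1' c : E (sfc c * 1) = c by rewrite EZ // E1 // mulr1.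
have Elo : s <= E u by rewrite -(E1' s); apply: E_le => // x Sx; rewrite !sfE mulr1 lo.
have Ehi : E u <= t by rewrite -(E1' t); apply: E_le => // x Sx; rewrite !sfE mulr1 hi.
have Hhi : E (h ^+ 7) <= s ^- 7.
  rewrite -(E1' (s ^- 7)); apply: E_le => // x Sx; rewrite !sfE mulr1 h_inv // -exprVn.
  by rewrite lerXn2r ?nnegrE ?invr_ge0 ?(ltW s0) ?(ltW (u0 Sx)) // lef_pV2 ?posrE ?u0 // lo.
have Hlo : t ^- 7 <= E (h ^+ 7).
  rewrite -(E1' (t ^- 7)); apply: E_le => // x Sx; rewrite !sfE mulr1 h_inv // -exprVn.
  by rewrite lerXn2r ?nnegrE ?invr_ge0 ?(ltW t0) ?(ltW (u0 Sx)) // lef_pV2 ?posrE ?u0 // hi.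
have eu : 0 < E u by exact: lt_le_trans Elo.
have s2 : s <= 2.
  apply: pow8_le => //; apply: le_trans Hhi; rewrite -EB.
  apply: le_trans (_ : 7 / 16 * E u <= _); first by rewrite ler_pM2l //; lra.
  by rewrite ler_pM2r.
have t1 : 1 <= t.
  apply: pow8_ge => //; apply: le_trans Hlo _; rewrite -EB.
  apply: le_trans (_ : 1 * E u <= _); last by rewrite mul1r.
  by rewrite ler_pM2r.
have h1 := lo p Sp; have h2 := hi p Sp.
by split; lra.
Qed.

End Solution.

End Estimates.

(** * Uniform bounds on higher derivatives *)

Section Bootstrap.
Variable R : realType.
Local Notation V := 'rV[R]_4.
Local Notation SF := (SF R).
Implicit Types (f g h u : SF) (x p : V) (c B C D : R) (a b : 'I_3) (m n : nat)
  (J : seq 'I_3).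

Definition wordX J f : SF := foldr (@sX R) f J.

Lemma wordX_rcons J a f : wordX (rcons J a) f = wordX J (sX a f).
Proof. by rewrite /wordX foldr_rcons. Qed.

Lemma wordX_D J f g : wordX J (f + g) = wordX J f + wordX J g.
Proof. by elim: J => //= a J ->; rewrite sXD. Qed.

Lemma wordX_N J f : wordX J (- f) = - wordX J f.
Proof. by elim: J => //= a J ->; rewrite sXN. Qed.

Lemma wordX_Z J c f : wordX J (sfc c * f) = sfc c * wordX J f.
Proof. by elim: J => //= a J ->; rewrite sXZ. Qed.

Lemma wordX_pan J f : pan (wordX J f) = wordX J (pan f).
Proof. by elim: J => //= a J IH; rewrite sX_pan IH. Qed.

Definition bd m C f := forall J, (size J <= m)%N ->
  forall x, S3 x -> `|wordX J f x| <= C.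

Lemma bd_le m n C D f : (m <= n)%N -> C <= D -> bd n C f -> bd m D f.
Proof.
move=> mn CD H J Jm x Sx; apply: le_trans CD; apply: H => //.
exact: leq_trans mn.
Qed.

(** The innermost derivative is split off, so that the product and quotient rules can be applied to
    [sX a f] before the remaining word acts. *)
Lemma bdS m C f : (forall x, S3 x -> `|f x| <= C) -> (forall a, bd m C (sX a f)) ->
  bd m.+1 C f.
Proof.
move=> H0 H J; case/lastP: J => [_ x Sx|J a]; first exact: H0.
by rewrite size_rcons ltnS => Jm x Sx; rewrite wordX_rcons; exact: H.
Qed.

Lemma bd0 m C f x : bd m C f -> S3 x -> `|f x| <= C.
Proof. by move=> H; exact: (H [::]). Qed.

Lemma bd_sX m C f a : bd m.+1 C f -> bd m C (sX a f).
Proof.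
move=> H J Jm x Sx; rewrite -wordX_rcons; apply: H => //.
by rewrite size_rcons.
Qed.

Lemma bd_add m C D f g : bd m C f -> bd m D g -> bd m (C + D) (f + g).
Proof.
move=> Hf Hg J Jm x Sx; rewrite wordX_D sfD; apply: le_trans (ler_normD _ _) _.
by rewrite lerD ?Hf ?Hg.
Qed.

Lemma bd_opp m C f : bd m C f -> bd m C (- f).
Proof. by move=> H J Jm x Sx; rewrite wordX_N sfN normrN H. Qed.

Lemma bd_mul m C D f g : 0 <= C -> 0 <= D -> bd m C f -> bd m D g ->
  bd m (2 ^+ m * (C * D)) (f * g).
Proof.
move=> C0 D0; elim: m f g => [|m IH] f g Hf Hg.
  move=> [|//] _ x Sx; rewrite expr0 mul1r /= normrM.
  by rewrite ler_pM ?(bd0 Hf) ?(bd0 Hg).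
have CD0 : 0 <= C * D by rewrite mulr_ge0.
apply: bdS => [x Sx|a].
  rewrite sfM normrM; apply: le_trans (_ : C * D <= _).
    by rewrite ler_pM ?(bd0 Hf) ?(bd0 Hg).
  by rewrite ler_peMl // exprn_ege1 // ler1n.
have -> : 2 ^+ m.+1 * (C * D) = 2 ^+ m * (C * D) + 2 ^+ m * (C * D).
  by rewrite exprS -mulrA mulr_natl mulr2n.
rewrite sXM; apply: bd_add; apply: IH.
- exact: bd_sX.
- exact: (bd_le (leqnSn m) (lexx _) Hg).
- exact: (bd_le (leqnSn m) (lexx _) Hf).
- exact: bd_sX.
Qed.

(** As X h = - h^2 X u, one more derivative of h costs one more of u and only the previous bound on
    h. *)
Lemma bd_inv m C D : 0 <= C -> 0 <= D -> exists B, 0 <= B /\ forall u h, u * h = 1 ->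
  (forall x, S3 x -> `|h x| <= D) -> bd m C u -> bd m B h.
Proof.
move=> C0 D0; elim: m => [|m [B [B0 IH]]].
  by exists D; split => // u h uh hD _ [|//] _ x Sx; exact: hD.
pose K := 2 ^+ m * (2 ^+ m * (B * B) * C).
have p0 : 0 <= 2 ^+ m * (B * B) by rewrite mulr_ge0 ?exprn_ge0 ?mulr_ge0.
have K0 : 0 <= K by rewrite !mulr_ge0 ?exprn_ge0.
exists (D + K); split; first by rewrite addr_ge0.
move=> u h uh hD Hu; have Hh := IH _ _ uh hD (bd_le (leqnSn m) (lexx _) Hu).
apply: bdS => [x Sx|a]; first by apply: le_trans (hD x Sx) _; rewrite lerDl.
rewrite (sX_inv a uh); apply: bd_opp.
apply: (bd_le (leqnn m) (_ : K <= _)); first by rewrite lerDr.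
by apply: bd_mul => //; [exact: bd_mul|exact: bd_sX].
Qed.

Lemma bd_one m : bd m 1 1.
Proof.
move=> J _ x Sx; case/lastP: J => [|J a]; first by rewrite /= normr1.
rewrite wordX_rcons sX1.
have E0 : sfc 0 = 0 :> SF by exact: val_inj.
have -> : wordX J 0 = 0 by elim: J => //= b J ->; rewrite -{1}E0 sXc.
by rewrite sf0 normr0.
Qed.

Lemma bd_exp m C n : 0 <= C -> exists B, 0 <= B /\ forall h, bd m C h -> bd m B (h ^+ n).
Proof.
move=> C0; elim: n => [|n [B [B0 IH]]].
  by exists 1; split => // h _; rewrite expr0; exact: bd_one.
exists (2 ^+ m * (C * B)); split; first by rewrite !mulr_ge0 ?exprn_ge0.
by move=> h Hh; rewrite exprS; apply: bd_mul => //; exact: IH.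
Qed.

Variable A : (V -> R) -> R.
Hypothesis hA : is_mean A.

Definition is_sol (eps : R) u h := [/\ 0 < eps, eps < 1 / 2, forall x, S3 x -> 0 < u x,
  u * h = 1 & pan u = - (h ^+ 7 + sfc eps * u)].

Lemma is_sol_bounds eps u h : is_sol eps u h ->
  forall p, S3 p -> 1 / 20 <= u p /\ u p <= 40.
Proof. by move=> [e0 e1 u0 uh eqn] p; exact: (sol_bounds hA e0 e1 u0 uh eqn). Qed.

Lemma is_sol_inv_le eps u h : is_sol eps u h -> forall x, S3 x -> `|h x| <= 20.
Proof.
move=> S x Sx; have [lo _] := is_sol_bounds S Sx; case: S => e0 e1 u0 uh eqn.
rewrite (h_inv u0 uh Sx) ger0_norm ?invr_ge0 ?(ltW (u0 _ Sx)) //.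
by rewrite -(invrK 20) lef_pV2 ?posrE ?invr_gt0 ?u0 //; move: lo; rewrite div1r.
Qed.

(** The equation bounds m derivatives of P u by m derivatives of u. As P commutes with words in the
    X_a, [grad_bound] applied to each word of length at most m yields order m + 1. *)
Lemma sol_smooth m : exists C, 0 <= C /\ forall eps u h, is_sol eps u h -> bd m C u.
Proof.
elim: m => [|m [C [C0 IH]]].
  exists 40; split => // eps u h S [|//] _ x Sx /=.
  by have [lo hi] := is_sol_bounds S Sx; rewrite ger0_norm //; lra.
have [B1 [B10 H1]] := bd_inv m C0 (ler0n R 20).
have [B2 [B20 H2]] := bd_exp m 7 B10.
pose B := B2 + C.
exists (40 + 16 / 15 * B); split.
  by rewrite addr_ge0 ?mulr_ge0 ?addr_ge0 //; lra.
move=> eps u h S; have Hu := IH _ _ _ S.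
have [e0 e1 u0 uh eqn] := S.
have Hh := H1 u h uh (is_sol_inv_le S) Hu.
have HF : bd m B (pan u).
  rewrite eqn; apply: bd_opp; apply: bd_add; first exact: H2.
  move=> J Jm x Sx; rewrite wordX_Z !sfE normrM; apply: le_trans (Hu J Jm x Sx).
  rewrite ler_piMl // gtr0_norm //; lra.
have B0 : 0 <= B by rewrite addr_ge0.
have B0' : 0 <= 16 / 15 * B by rewrite mulr_ge0.
move=> [|a J] Jm x Sx.
  apply: le_trans (_ : 40 <= _); last by rewrite lerDl.
  by have [lo hi] := is_sol_bounds S Sx; rewrite /= ger0_norm //; lra.
apply: le_trans (_ : 16 / 15 * B <= _); last by rewrite lerDr.
apply: (grad_bound hA) => // y Sy; rewrite wordX_pan; exact: HF.
Qed.

End Bootstrap.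

(** * Covariant derivatives *)

Section Covariant.
Variable R : realType.
Local Notation V := 'rV[R]_4.
Local Notation SF := (SF R).
Local Notation M := (qmx R).
Implicit Types (f g h : SF) (u : V -> R) (x p q v w : V) (c B C D : R) (a b : 'I_3).

Lemma derive_tproj g p v : S3 p ->
  'D_(tproj p v) g p = \sum_(a < 3) dot v (p *m M a) * sX a g p.
Proof.
move=> Sp; have p0 := S3_neq0 Sp.
have -> : tproj p v = \sum_(a < 3) dot v (p *m M a) *: (p *m M a).
  apply/rowP => i; have := dot_qmx_frame p v (std_basis R i).
  rewrite (S3_dot Sp) mul1r dot_std_basis (dotC (std_basis R i) p) dot_std_basis => E.
  rewrite summxE [LHS]mxE [X in _ + X]mxE [X in _ - X]mxE E (dotC v p) addrAC subrr add0r.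
  apply: eq_bigr => a _.
  by rewrite (dotC (std_basis R i)) dot_std_basis [RHS]mxE.
rewrite deriveE; last exact: SF_diff.
rewrite linear_sum; apply: eq_bigr => a _.
by rewrite (sXE a g Sp) linearZ deriveE //; exact: SF_diff.
Qed.

Lemma derive_radial (T : V -> R) g p v : S3 p -> (forall q, S3 q -> T q = g q) ->
  'D_v (fun x => T (radial x)) p = 'D_v g p.
Proof.
move=> Sp Tg; apply: (@near_eq_derive R V R (fun x => T (radial x)) g).
apply: filterS (near_neq0 (S3_neq0 Sp)) => x x0.
by rewrite Tg; [rewrite -rho_neq0 // SF_rho|exact: S3_radial].
Qed.

Definition agree f u := forall x, S3 x -> u x = f x.

Lemma nabla1E f u p (ws : 1.-tuple V) : agree f u -> S3 p ->
  nabla_iter 1 u p ws = \sum_(a < 3) dot (thead ws) (p *m M a) * sX a f p.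
Proof.
move=> fu Sp /=; rewrite /nabla (@derive_radial u f) // derive_tproj //.
Qed.

(** The Hessian in the left-invariant frame; the terms with two matrices come from differentiating
    the frame itself. *)
Lemma nabla2E f u p v w : agree f u -> S3 p ->
  nabla_iter 2 u p [tuple v; w] =
  \sum_(b < 3) dot v (p *m M b) * \sum_(a < 3)
    (dot (tproj p w) (p *m M b *m M a) * sX a f p
     + dot (tproj p w) (p *m M a) * sX b (sX a f) p).
Proof.
move=> fu Sp; set w' := tproj p w.
(* The argument w' is frozen at p. Its projection at q may be omitted, because the frame vectors at
   q are already tangent. *)
pose g : SF := \sum_(a < 3) - sy (w' *m M a) * sX a f.
have gE q : S3 q -> nabla_iter 1 u q (map_tuple (tproj p) (behead_tuple [tuple v; w])) = g q.
  move=> Sq; rewrite (nabla1E _ fu Sq) /g !sum_ord3 !sfE !syE //.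
  have -> : thead (map_tuple (tproj p) (behead_tuple [tuple v; w])) = w' by [].
  by rewrite !dot_mulqmx.
have -> : nabla_iter 2 u p [tuple v; w] = 'D_(tproj p v) g p.
  rewrite -(@derive_radial (fun q => nabla_iter 1 u q
    (map_tuple (tproj p) (behead_tuple [tuple v; w])))) //.
rewrite derive_tproj //; apply: eq_bigr => b _; congr (_ * _).
have E a : sX b (- sy (w' *m M a) * sX a f) p =
   dot w' (p *m M b *m M a) * sX a f p + dot w' (p *m M a) * sX b (sX a f) p.
  rewrite sXM sXN sX_y opprK !sfE !syE // -dot_mulqmx; congr (_ * _ + _).
  by rewrite -(opprK (dot (w' *m M a *m M b) p)) -dot_mulqmx -dot_mulqmx.
pose t a : SF := - sy (w' *m M a) * sX a f.
have -> : g = t 0 + t 1 + t 2 by rewrite /g sum_ord3.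
rewrite (sXD b (t 0 + t 1) (t 2)) (sXD b (t 0) (t 1)) sum_ord3.
by rewrite -(E 0) -(E 1) -(E 2).
Qed.

Lemma sum_std_basis_dot p v w : S3 p -> dot p v = 0 ->
  \sum_(i < 4) dot (std_basis R i) v * dot (tproj p (std_basis R i)) w = dot v w.
Proof.
move=> Sp pv.
transitivity (\sum_(i < 4) (v 0 i * w 0 i - (dot p w) * (p 0 i * v 0 i))).
  apply: eq_bigr => i _; rewrite /tproj dotBl dotZl.
  rewrite (dotC (std_basis R i) v) (dotC (std_basis R i) w).
  by rewrite !dot_std_basis; ring.
by rewrite sumrB -mulr_sumr -/(dot p v) pv mulr0 subr0.
Qed.

Lemma laplace_beltramiE f u p : agree f u -> S3 p -> laplace_beltrami u p = lap f p.
Proof.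
move=> fu Sp; rewrite /laplace_beltrami.
transitivity (\sum_(b < 3) \sum_(a < 3)
    (dot (p *m M b) (p *m M b *m M a) * sX a f p
     + dot (p *m M b) (p *m M a) * sX b (sX a f) p)).
  rewrite (eq_bigr _ (fun i _ => nabla2E (std_basis R i) (std_basis R i) fu Sp)).
  rewrite exchange_big /=; apply: eq_bigr => b _.
  transitivity (\sum_(a < 3) \sum_(i < 4) dot (std_basis R i) (p *m M b) *
    (dot (tproj p (std_basis R i)) (p *m M b *m M a) * sX a f p
     + dot (tproj p (std_basis R i)) (p *m M a) * sX b (sX a f) p)).
    by rewrite exchange_big /=; apply: eq_bigr => i _; rewrite mulr_sumr.
  apply: eq_bigr => a _.
  rewrite -!(sum_std_basis_dot _ Sp (dot_qmx p b)) !mulr_suml -big_split /=.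
  by apply: eq_bigr => i _; rewrite mulrDr !mulrA.
transitivity (\sum_(b < 3) sX b (sX b f) p); last by rewrite sum_ord3.
(* The first-order terms vanish because p M_b and p M_b M_a are orthogonal; orthonormality of the
   frame keeps only the diagonal second-order terms. *)
apply: eq_bigr => b _; rewrite (bigD1 b) //= big1 => [|a ab].
  by rewrite dot_qmx dot_qmx_orth eqxx (S3_dot Sp) mulr1 mul0r mul1r add0r addr0.
by rewrite dot_qmx dot_qmx_orth eq_sym (negbTE ab) !mul0r addr0.
Qed.

Lemma paneitzE f u p : agree f u -> S3 p -> paneitz u p = pan f p.
Proof.
move=> fu Sp; rewrite /paneitz.
have L : agree (lap f) (laplace_beltrami u) by move=> x Sx; exact: laplace_beltramiE.
by rewrite (laplace_beltramiE L Sp) (laplace_beltramiE fu Sp) fu.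
Qed.

(* Polynomial expressions in the point q, the argument vectors and the iterated
   derivatives X^J f: every nabla^k f has this form, with coefficients
   independent of f. *)
Inductive dpoly (k : nat) : (SF -> V -> k.-tuple V -> R) -> Prop :=
| dpoly_cst c : dpoly (fun _ _ _ => c)
| dpoly_pt i : dpoly (fun _ q _ => q 0 i)
| dpoly_arg l i : dpoly (fun _ _ vs => (tnth vs l) 0 i)
| dpoly_wordX J : dpoly (fun f q _ => wordX J f q)
| dpoly_add P Q : dpoly P -> dpoly Q -> dpoly (fun f q vs => P f q vs + Q f q vs)
| dpoly_mul P Q : dpoly P -> dpoly Q -> dpoly (fun f q vs => P f q vs * Q f q vs).

Lemma dpoly_sum k (I : Type) (r : seq I) (P : I -> SF -> V -> k.-tuple V -> R) :
  (forall i, dpoly (P i)) -> dpoly (fun f q vs => \sum_(i <- r) P i f q vs).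
Proof.
move=> HP; elim: r => [|i r IH].
  rewrite (_ : (fun _ _ _ => _) = fun _ _ _ => 0); first exact: dpoly_cst.
  by apply/funext => f; apply/funext => q; apply/funext => vs; rewrite big_nil.
rewrite (_ : (fun _ _ _ => _) = fun f q vs => P i f q vs + \sum_(j <- r) P j f q vs).
  exact: dpoly_add.
by apply/funext => f; apply/funext => q; apply/funext => vs; rewrite big_cons.
Qed.

(** The argument vectors stay fixed while the point moves, in accordance with [nabla], which
    projects them at p before differentiating. The function g makes the expression an element of
    [SF], to which X_a can be applied. *)
Lemma dpoly_derive k (P : SF -> V -> k.-tuple V -> R) : dpoly P ->
  exists Q : 'I_3 -> SF -> V -> k.-tuple V -> R, (forall a, dpoly (Q a)) /\
  forall f vs, exists g : SF, (forall q, S3 q -> P f q vs = g q) /\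
    forall a q, S3 q -> sX a g q = Q a f q vs.
Proof.
elim => [c|i|l i|J|P1 P2 _ [Q1 [H1 E1]] _ [Q2 [H2 E2]]|P1 P2 D1 [Q1 [H1 E1]] D2 [Q2 [H2 E2]]].
- exists (fun _ _ _ _ => 0); split => [a|f vs]; first exact: dpoly_cst.
  by exists (sfc c); split => // a q _; rewrite sXc.
- exists (fun a _ q _ => \sum_(j < 4) - (std_basis R i *m M a) 0 j * q 0 j).
  split => [a|f vs].
    by apply: dpoly_sum => j; apply: dpoly_mul; [exact: dpoly_cst|exact: dpoly_pt].
  exists (sy (std_basis R i)); split => [q Sq|a q Sq].
    by rewrite syE // dotC dot_std_basis.
  rewrite sX_y sfN syE // /dot -sumrN.
  by apply: eq_bigr => j _; rewrite mulNr.
- exists (fun _ _ _ _ => 0); split => [a|f vs]; first exact: dpoly_cst.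
  by exists (sfc ((tnth vs l) 0 i)); split => // a q _; rewrite sXc.
- exists (fun a f q _ => wordX (a :: J) f q); split => [a|f vs]; first exact: dpoly_wordX.
  by exists (wordX J f).
- exists (fun a f q vs => Q1 a f q vs + Q2 a f q vs); split => [a|f vs].
    exact: dpoly_add.
  have [g1 [G1 K1]] := E1 f vs; have [g2 [G2 K2]] := E2 f vs.
  exists (g1 + g2); split => [q Sq|a q Sq]; first by rewrite sfD G1 // G2.
  by rewrite sXD sfD K1 // K2.
- exists (fun a f q vs => Q1 a f q vs * P2 f q vs + P1 f q vs * Q2 a f q vs).
  split => [a|f vs].
    by apply: dpoly_add; apply: dpoly_mul => //.
  have [g1 [G1 K1]] := E1 f vs; have [g2 [G2 K2]] := E2 f vs.
  exists (g1 * g2); split => [q Sq|a q Sq]; first by rewrite sfM G1 // G2.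
  by rewrite sXM sfD !sfM K1 // K2 // G1 // G2.
Qed.

Lemma dpoly_tproj k (P : SF -> V -> k.-tuple V -> R) : dpoly P ->
  dpoly (fun f q (vs : k.+1.-tuple V) => P f q (map_tuple (tproj q) (behead_tuple vs))).
Proof.
elim => [c|i|l i|J|P1 P2 _ H1 _ H2|P1 P2 _ H1 _ H2].
- exact: dpoly_cst.
- exact: dpoly_pt.
- have S : dpoly (fun (_ : SF) q (vs : k.+1.-tuple V) =>
      (tnth vs (inord l.+1)) 0 i
      + -1 * ((\sum_(j < 4) q 0 j * (tnth vs (inord l.+1)) 0 j) * q 0 i)).
    apply: dpoly_add; first exact: dpoly_arg.
    apply: dpoly_mul; first exact: dpoly_cst.
    apply: dpoly_mul; last exact: dpoly_pt.
    by apply: dpoly_sum => j; apply: dpoly_mul; [exact: dpoly_pt|exact: dpoly_arg].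
  move: S; congr dpoly.
  apply/funext => f; apply/funext => q; apply/funext => vs.
  by rewrite tnth_map tnth_behead /tproj !mxE mulN1r.
- exact: dpoly_wordX.
- exact: dpoly_add.
- exact: dpoly_mul.
Qed.

Lemma nabla_dpoly k : exists P : SF -> V -> k.-tuple V -> R, dpoly P /\
  forall f u, agree f u -> forall p, S3 p -> forall vs, nabla_iter k u p vs = P f p vs.
Proof.
elim: k => [|k [P [HP EP]]].
  exists (fun f q _ => wordX [::] f q); split; first exact: dpoly_wordX.
  by move=> f u fu p Sp vs; exact: fu.
have [Q [HQ EQ]] := dpoly_derive HP.
exists (fun (f : SF) (q : V) (vs : k.+1.-tuple V) => \sum_(a < 3)
  (\sum_(j < 4) (tnth vs ord0) 0 j * (\sum_(i < 4) q 0 i * M a i j)) *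
  Q a f q (map_tuple (tproj q) (behead_tuple vs))); split.
  apply: dpoly_sum => a; apply: dpoly_mul; last exact: (dpoly_tproj (HQ a)).
  apply: dpoly_sum => j; apply: dpoly_mul; first exact: dpoly_arg.
  by apply: dpoly_sum => i; apply: dpoly_mul; [exact: dpoly_pt|exact: dpoly_cst].
move=> f u fu p Sp vs.
have [g [G1 G2]] := EQ f (map_tuple (tproj p) (behead_tuple vs)).
rewrite /= /nabla (@derive_radial (fun x => nabla_iter k u x
  (map_tuple (tproj p) (behead_tuple vs))) g) //.
  rewrite derive_tproj //; apply: eq_bigr => a _; rewrite G2 //; congr (_ * _).
  by apply: eq_bigr => j _; rewrite mxE.
by move=> q Sq; rewrite (EP f u fu q Sq) G1.
Qed.

(** The order m depends on the expression alone and is chosen before B, since [sol_smooth] supplies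
    B only once m is known. *)
Lemma dpoly_bound k (P : SF -> V -> k.-tuple V -> R) : dpoly P -> exists m, forall B, exists C,
  forall f, bd m B f -> forall q, S3 q -> forall I : k.-tuple 'I_4,
    `|P f q (map_tuple (@std_basis R) I)| <= C.
Proof.
elim => [c|i|l i|J|P1 P2 _ [m1 H1] _ [m2 H2]|P1 P2 _ [m1 H1] _ [m2 H2]].
- by exists 0%N => B; exists `|c|.
- exists 0%N => B; exists 1 => f _ q Sq I.
  by have := normr_dot_le q (std_basis R i); rewrite dot_std_basis S3_std_basis Sq mulr1.
- exists 0%N => B; exists 1 => f _ q Sq I; rewrite tnth_map !mxE.
  by case: (_ && _); rewrite ?normr1 ?normr0.
- by exists (size J) => B; exists B => f Hf q Sq I; exact: Hf.
- exists (maxn m1 m2) => B; have [C1 K1] := H1 B; have [C2 K2] := H2 B.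
  exists (C1 + C2) => f Hf q Sq I; apply: le_trans (ler_normD _ _) _.
  apply: lerD; [apply: K1 => //|apply: K2 => //].
    exact: (bd_le (leq_maxl m1 m2) (lexx _) Hf).
  exact: (bd_le (leq_maxr m1 m2) (lexx _) Hf).
- exists (maxn m1 m2) => B; have [C1 K1] := H1 B; have [C2 K2] := H2 B.
  exists (C1 * C2) => f Hf q Sq I; rewrite normrM.
  apply: ler_pM => //; [apply: K1 => //|apply: K2 => //].
    exact: (bd_le (leq_maxl m1 m2) (lexx _) Hf).
  exact: (bd_le (leq_maxr m1 m2) (lexx _) Hf).
Qed.

Lemma smooth_Sn (F : V -> R) :
  (forall s x, x != 0 -> differentiable (iter_partial s F) x) -> forall n, Sn n F.
Proof.
move=> dF n; elim: n F dF => [|n IH] F dF /=; (split; first exact: (dF [::])) => // i.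
apply: IH => s x x0; have := dF (rcons s i) x x0.
by rewrite /iter_partial foldr_rcons.
Qed.

Lemma smooth_SF u : smooth_S3 u -> exists f : SF, agree f u.
Proof.
move=> su.
have S : u \o (@rho R) \in @smf R.
  apply/smfP; split => [n|x]; last by rewrite /= rhoK.
  by apply: Sn_ext (smooth_Sn su n) => x x0; rewrite /= rho_neq0.
by exists (MkSF S) => x Sx; rewrite /= rho_id.
Qed.

Lemma tensor_norm_bound k : exists m, forall B, exists C, 0 <= C /\ forall f u,
  agree f u -> bd m B f -> forall p, S3 p -> tensor_norm (nabla_iter k u) p <= C.
Proof.
have [P [HP EP]] := nabla_dpoly k; have [m Hm] := dpoly_bound HP.
exists m => B; have [C HC] := Hm B.
exists (Num.sqrt (\sum_(I : k.-tuple 'I_4) C ^+ 2)); split; first exact: sqrtr_ge0.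
move=> f u fu Hf p Sp; rewrite /tensor_norm ler_wsqrtr //.
apply: ler_sum => I _; rewrite (EP f u fu p Sp).
have H1 := HC f Hf p Sp I.
rewrite -real_normK ?num_real // lerXn2r ?nnegrE //.
exact: le_trans H1.
Qed.

End Covariant.

Theorem theorem1p1 (R : realType) :
  exists eps0 : R, 0 < eps0 /\
  forall k : nat, exists A0 C0 : R, 0 < A0 /\ 0 < C0 /\
  forall (eps : R) (u : 'rV[R]_4 -> R),
    0 < eps -> eps < eps0 ->
    smooth_S3 u ->
    (forall p, S3 p -> 0 < u p) ->
    (forall p, S3 p -> paneitz u p + eps * u p = - (u p) ^- 7) ->
    (forall p, S3 p -> 1 / A0 <= u p /\ u p <= A0) /\
    (Ck_norm k u <= C0%:E)%E.
Proof.
have [A hA] := ex_mean R.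
have sol (eps : R) u : 0 < eps -> eps < 1 / 2 -> smooth_S3 u ->
    (forall p, S3 p -> 0 < u p) ->
    (forall p, S3 p -> paneitz u p + eps * u p = - (u p) ^- 7) ->
    exists f h : SF R, agree f u /\ is_sol eps f h.
  move=> e0 e1 su u0 eqn; have [f fu] := smooth_SF su.
  have f0 x : S3 x -> 0 < f x by move=> Sx; rewrite -fu // u0.
  have [h fh] : exists h : SF R, f * h = 1 by apply: ex_sinv => x Sx; rewrite gt_eqF // f0.
  exists f, h; split => //; split => //.
  apply: SF_eq => x Sx; rewrite -(paneitzE fu Sx) sfN sfD sfM sfX sfcE (h_inv f0 fh Sx) -fu //.
  by have := eqn x Sx; rewrite exprVn; set t := _ ^- 7; lra.
(* Below 1/2 the coefficient 15/16 - eps of the integrated equation stays above 7/16. *)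
exists (1 / 2); split => // k.
have [C [C0 HC]] : exists C : R, 0 <= C /\ forall (eps : R) f h u, is_sol eps f h ->
    agree f u -> (Ck_norm k u <= C%:E)%E.
  pose good (j : nat) (c : R) := 0 <= c /\
    forall (eps : R) (f h : SF R) (u : 'rV[R]_4 -> R), is_sol eps f h -> agree f u ->
    forall p, S3 p -> tensor_norm (nabla_iter j u) p <= c.
  have good_ex j : exists c, good j c.
    have [m Hm] := tensor_norm_bound R j; have [B [_ HB]] := sol_smooth hA m.
    have [c [c0 Hc]] := Hm B; exists c; split => // eps f h u S fu.
    exact: (Hc f u fu (HB _ _ _ S)).
  have [T HT] := choice good_ex.
  exists (\sum_(j < k.+1) T j); split; first by apply: sumr_ge0 => j _; case: (HT j).
  move=> eps f h u S fu; rewrite /Ck_norm -sumEFin; apply: lee_sum => j _.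
  apply: ge_ereal_sup => _ [p Sp <-]; rewrite lee_fin.
  by have [_ H1] := HT j; exact: (H1 eps f h u S fu).
(* The lower bound 1/20 is better than the required 1/40; adding 1 makes the second constant
   strictly positive. *)
exists 40, (C + 1); split => //; split; first by rewrite ltr_wpDl.
move=> eps u e0 e1 su u0 eqn.
have [f [h [fu S]]] := sol eps u e0 e1 su u0 eqn; split.
  move=> p Sp; rewrite fu //; have [lo hi] := is_sol_bounds hA S Sp.
  by split => //; apply: le_trans lo; lra.
apply: le_trans (HC eps f h u S fu) _.
by rewrite lee_fin lerDl.
Qed.
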